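(* There exists a residual subset $\mathcal{R}\subset C([0,1])$ such that for every $f\in\mathcal{R}$ the set $\Omega(f)$ is a Cantor set of zero Hausdorff dimension and $A_{\mathrm{phys}}(f)=A_{\mathrm{stat}}(f)=\Lambda(f)=\Omega(f)$, and such that moreover, for every $f\in\mathcal{R}$: the global Milnor attractor $\Lambda(f)$ is robust at $f$, satisfies $\Lambda(f)=\Omega(f)$, and is not Lyapunov stable; and every $f$-invariant probability measure has a basin of zero Lebesgue measure.
   Context: $C([0,1])$ is the space of continuous maps $f:[0,1]\to[0,1]$ with the uniform metric $\|f-g\|_\infty=\sup_{x}|f(x)-g(x)|$; residual means containing a countable intersection of dense open sets. $\lambda$ is Lebesgue measure on $[0,1]$; ''almost all'' refers to $\lambda$. Topological notions are those of the space $[0,1]$. $\chi_U$ is the indicator function of $U$. $\omega(x)=\omega_f(x)=\bigcap_{n\ge 0}\overline{\{f^m(x):m\ge n\}}$. A point $x$ is non-wandering if for every neighborhood $U$ of $x$ there is $n>0$ with $f^n(U)\cap U\neq\emptyset$; $\Omega(f)$ is the set of non-wandering points. Global Milnor attractor $\Lambda(f)$: the smallest closed set containing $\omega(x)$ for $\lambda$-almost all $x\in[0,1]$. Statistical attractor $A_{\mathrm{stat}}(f)$: the smallest closed set such that for every neighborhood $U$ of it, $\lim_{n\to\infty}\frac1n\sum_{k=0}^{n-1}\chi_U(f^k(x))=1$ for $\lambda$-almost all $x\in[0,1]$. An open set $U\subset[0,1]$ is essential if there are a sequence of positive integers $k_n\to+\infty$ and constants $\varepsilon,\delta>0$ such that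 for every $n$, $\lambda\big(\{x:\frac1{k_n}\sum_{i=0}^{k_n-1}\chi_U(f^i(x))>\varepsilon\}\big)>\delta$. Physical attractor $A_{\mathrm{phys}}(f)$: the complement in $[0,1]$ of the union of all open sets that are not essential. The global Milnor attractor is robust at $f$ if the map $g\mapsto\Lambda(g)$, from $C([0,1])$ to the nonempty compact subsets of $[0,1]$ with the Hausdorff metric $d_H$, is continuous at $f$, i.e. $d_H(\Lambda(g),\Lambda(f))\to0$ whenever $g\to f$ uniformly. A nonempty closed set $A$ with $f(A)=A$ is Lyapunov stable if for every open $U\supset A$ there is an open $V\supset A$ such that $f^n(x)\in U$ for all $x\in V$, $n\ge0$. The basin of an $f$-invariant Borel probability measure $\mu$ is the set of $x\in[0,1]$ such that $\frac1n\sum_{i=0}^{n-1}\delta_{f^i(x)}\to\mu$ in the weak-$*$ topology, where $\delta_z$ is the Dirac measure at $z$. *)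

(* Defs.v *)
From HB Require Import structures.
From mathcomp Require Import all_boot all_order all_algebra.
From mathcomp Require Import all_classical all_reals all_analysis borel_hierarchy.

Set Implicit Arguments.
Unset Strict Implicit.
Unset Printing Implicit Defensive.

Import Order.TTheory GRing.Theory Num.Theory.
Import numFieldNormedType.Exports.

Local Open Scope classical_set_scope.
Local Open Scope ring_scope.

(* The unit interval is a space of its own: open, closed, neighborhood, dense
   etc. for subsets of [I01 R] are the notions of [0,1], not of the line. *)
Definition I01 (R : realType) : Type := set_type (`[0, 1]%classic : set R).
HB.instance Definition _ (R : realType) := PseudoMetric.on (I01 R).

Lemma I01_0_subproof (R : realType) : (0 : R) \in (`[0, 1]%classic : set R).
Proof. by rewrite inE/= in_itv/= lexx ler01. Qed.

HB.instance Definition _ (R : realType) :=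
  isPointed.Build (I01 R) (exist _ 0 (I01_0_subproof R)).

Definition I01_val (R : realType) (x : I01 R) : R := set_val x.

Definition C01 (R : realType) : Type := continuousType (I01 R) (I01 R).
(* The topology of uniform convergence, see [ball_C01E]. *)
HB.instance Definition _ (R : realType) := Choice.on (C01 R).
HB.instance Definition _ (R : realType) := PseudoMetric.copy (C01 R)
  (initial_topology
     (fun (f : C01 R) => (f : arrow_uniform_type (I01 R) (I01 R)))).

Section topology.
Context {R : realType}.

Lemma ball_I01E (x y : I01 R) e : ball x e y = (`|I01_val x - I01_val y| < e) :> Prop.
Proof. by []. Qed.

Lemma ball_C01E (f g : C01 R) e :
  ball f e g = (forall x, `|I01_val (f x) - I01_val (g x)| < e) :> Prop.
Proof. by []. Qed.

Definition residual (T : topologicalType) (A : set T) :=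
  exists2 G : set T, Gdelta_dense G & G `<=` A.

Definition cantor_set (A : set (I01 R)) :=
  [/\ A !=set0, compact A, perfect_set A & totally_disconnected A].

Definition hausdorff_dist (A B : set (I01 R)) : \bar R :=
  maxe (ereal_sup [set edist_inf B a | a in A])
       (ereal_sup [set edist_inf A b | b in B]).

(* [sup set0 = 0], so the empty set has diameter 0. *)
Definition diam (A : set (I01 R)) : R :=
  sup [set `|I01_val z.1 - I01_val z.2| | z in A `*` A].

Definition hausdorff_premeasure (s d : R) (A : set (I01 R)) : \bar R :=
  ereal_inf [set (\sum_(0 <= i <oo) (diam (U i) `^ s)%:E)%E |
    U in [set U : nat -> set (I01 R) |
           A `<=` \bigcup_i U i /\ forall i, diam (U i) <= d]].

Definition hausdorff_measure (s : R) (A : set (I01 R)) : \bar R :=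
  ereal_sup [set hausdorff_premeasure s d A | d in [set d : R | 0 < d]].

(* The infimum is over s > 0 to avoid the convention for 0 `^ 0. *)
Definition hausdorff_dim (A : set (I01 R)) : \bar R :=
  ereal_inf [set s%:E | s in [set s : R | 0 < s /\ hausdorff_measure s A = 0%E]].

(* [lebesgue_measure] is given on all subsets of the line by the Lebesgue outer
   measure, so [lam A = 0] means that [A] is Lebesgue-null for every [A]. *)
Definition lam (A : set (I01 R)) : \bar R :=
  (@lebesgue_measure R) (@I01_val R @` A).

Definition almost_all (P : I01 R -> Prop) : Prop :=
  (@lebesgue_measure R).-negligible (@I01_val R @` [set x | ~ P x]).

End topology.

Section dynamics.
Context {R : realType}.
Implicit Types (f : C01 R) (x : I01 R) (A U : set (I01 R)).

Definition omega_limit f x : set (I01 R) :=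
  \bigcap_(n : nat) closure [set iter m f x | m in [set m | (n <= m)%N]].

Definition nonwandering f x :=
  forall U, nbhs x U -> exists2 n, (0 < n)%N & (iter n f @` U) `&` U !=set0.

Definition Omega f : set (I01 R) := [set x | nonwandering f x].

Definition carries_omega_limits f A :=
  closed A /\ almost_all (fun x => omega_limit f x `<=` A).

Definition milnor_attractor f : set (I01 R) :=
  smallest (carries_omega_limits f) set0.

Definition frequency f U n x : R :=
  n%:R^-1 * \sum_(k < n) \1_U (iter k f x).

Definition attracts_statistically f A :=
  closed A /\ forall U, A `<=` interior U ->
    almost_all (fun x => frequency f U n x @[n --> \oo] --> (1 : R)).

Definition stat_attractor f : set (I01 R) :=
  smallest (attracts_statistically f) set0.

Definition essential f U :=
  open U /\ exists k : nat -> nat,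
    [/\ forall n, (0 < k n)%N, k n @[n --> \oo] --> \oo &
      exists e d : R, [/\ 0 < e, 0 < d &
        forall n, (d%:E < lam [set x | (e < frequency f U (k n) x)%R])%E]].

Definition phys_attractor f : set (I01 R) :=
  ~` \bigcup_(U in [set U | open U /\ ~ essential f U]) U.

Definition milnor_robust f :=
  hausdorff_dist (milnor_attractor g) (milnor_attractor f) @[g --> f] --> 0%E.

(* The notion is meant for nonempty closed sets A with f(A) = A. For the Milnor
   attractor see [milnor_attractor_nonempty], [milnor_attractor_closed] and
   [milnor_attractor_invariant]. *)
Definition lyapunov_stable f A :=
  forall U, open U -> A `<=` U ->
    exists V : set (I01 R), [/\ open V, A `<=` V &
      forall x n, V x -> U (iter n f x)].

End dynamics.

(* [milnor_attractor] and [stat_attractor] are defined as intersections; the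
   lemmas [milnor_attractor_carries] and [stat_attractor_attracts] show that
   these intersections have the defining property, so that they are indeed the
   smallest closed sets with it. *)
Section attractors.
Context {R : realType}.
Implicit Types (f : C01 R) (x : I01 R) (A U V : set (I01 R)).

Lemma almost_allS (P Q : I01 R -> Prop) :
  (forall x, P x -> Q x) -> almost_all P -> almost_all Q.
Proof.
move=> PQ; apply: negligibleS => _ [x nQ <-]; exists x => // /=.
by move/PQ.
Qed.

Lemma almost_all_and (P Q : I01 R -> Prop) :
  almost_all P -> almost_all Q -> almost_all (fun x => P x /\ Q x).
Proof.
move=> aP aQ; apply: negligibleS (negligibleU aP aQ) => _ [x nPQ <-].
have [Px|nPx] := pselect (P x); last by left; exists x.
by right; exists x => // Qx; exact: nPQ.
Qed.

Lemma almost_all_forall (I : countType) (P : I -> I01 R -> Prop) :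
  (forall i, almost_all (P i)) -> almost_all (fun x => forall i, P i x).
Proof.
move=> aP.
pose F n : set R := if unpickle n is Some i then @I01_val R @` [set x | ~ P i x]
                    else set0.
have nF n : (@lebesgue_measure R).-negligible (F n).
  by rewrite /F; case: unpickle => [i|]; [exact: aP|exact: negligible_set0].
apply: negligibleS (negligible_bigcup nF).
move=> _ [x /existsNP[i nP] <-].
by exists (pickle i) => //; rewrite /F pickleK; exists x.
Qed.

Lemma almost_allW (P : I01 R -> Prop) : (forall x, P x) -> almost_all P.
Proof.
move=> aP; apply: negligibleS (@negligible_set0 _ _ _ lebesgue_measure).
by move=> r [x /= nPx _]; have := nPx (aP x).
Qed.

Lemma almost_all_ex (P : I01 R -> Prop) : almost_all P -> exists x, P x.
Proof.
move=> aP; apply/not_existsP => nP.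
have : (@lebesgue_measure R).-negligible `[0, 1]%classic.
  apply: negligibleS aP => x x01; exists (exist _ x (mem_set x01)) => //.
  exact: nP.
move=> /negligibleP => /(_ (measurable_itv _)) l0.
have := lebesgue_measure_itv (`[0, 1] : interval R).
rewrite [LHS]l0 /= lte_fin ltr01 oppr0 adde0 => /eqP.
by rewrite eqe eq_sym oner_eq0.
Qed.

Definition rat_ball (qn : rat * nat) : set (I01 R) :=
  [set z | `|I01_val z - ratr qn.1| < qn.2.+1%:R^-1].

Lemma rat_ball_basis x U : nbhs x U ->
  exists2 qn, rat_ball qn x & rat_ball qn `<=` U.
Proof.
move=> /nbhs_ballP[e /= e0 eU].
have e20 : 0 < e / 2 by rewrite divr_gt0.
have [n _ /(_ n (leqnn n)) /= ne] := near_infty_natSinv_lt (PosNum e20).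
have n0 : 0 < n.+1%:R^-1 :> R by rewrite invr_gt0.
have [|q] := @rat_in_itvoo R (I01_val x - n.+1%:R^-1) (I01_val x + n.+1%:R^-1).
  by rewrite ltrBlDr -addrA ltrDl addr_gt0.
rewrite in_itv/= => /andP[q1 q2].
have xq : rat_ball (q, n) x.
  by rewrite /rat_ball/= ltr_distlC q1.
exists (q, n) => // z /= zq; apply: eU.
rewrite ball_I01E (splitr e) (le_lt_trans (ler_distD (ratr q) _ _))// ltrD//.
  by rewrite (lt_trans xq).
by rewrite distrC (lt_trans zq).
Qed.

Lemma compact_I01 : compact [set: I01 R].
Proof.
move=> F FF _.
have [|p [p01 cp]] := @segment_compact R 0 1 ((@I01_val R) @ F) _.
  by apply: (@filterE _ F) => -[r r01]; exact: set_mem r01.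
exists (exist _ p (mem_set p01)); split=> // A B FA /nbhs_ballP[e /= e0 eB].
have FA' : F (@I01_val R @^-1` (@I01_val R @` A)).
  by apply: filterS FA => x Ax; exists x.
have [_ [[x Ax <-] xe]] := cp (@I01_val R @` A) _ FA' (nbhsx_ballx p _ e0).
by exists x; split => //; apply: eB; exact: xe.
Qed.

Lemma omega_limit_nonempty f x : omega_limit f x !=set0.
Proof.
have [//|y [_ cy]] := @compact_I01 ((fun n => iter n f x) @ \oo) _.
  exact: filterT.
exists y => n _ U Uy.
have [|z [zA Uz]] := cy [set iter m f x | m in [set m | (n <= m)%N]] U _ Uy.
  by exists n => // m /= nm; exists m.
by exists z.
Qed.

Lemma milnor_attractor_carries f : carries_omega_limits f (milnor_attractor f).
Proof.
split; first by apply: closed_bigI => A [[]].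
have /almost_allS : almost_all (fun x => forall qn : rat * nat,
    (exists2 A, carries_omega_limits f A & A `&` rat_ball qn = set0) ->
    omega_limit f x `&` rat_ball qn = set0).
  apply: almost_all_forall => qn.
  have [[A [cA aA] AB]|nA] := pselect (exists2 A,
      carries_omega_limits f A & A `&` rat_ball qn = set0); last first.
    exact: almost_allW.
  apply: almost_allS aA => x xA _.
  by rewrite -subset0 -AB => y [/xA].
apply => x xP y xy A [[cA aA] _].
apply: contrapT => nAy.
have [|qn yqn qnA] := @rat_ball_basis y (~` A).
  by apply: open_nbhs_nbhs; split => //; exact/closed_openC.
suff : (omega_limit f x `&` rat_ball qn) y by rewrite xP//; exists A => //;
  rewrite -subset0 => z [Az /qnA]; exact.
by split.
Qed.

Lemma milnor_attractor_nonempty f : milnor_attractor f !=set0.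
Proof.
have [x xA] := almost_all_ex (milnor_attractor_carries f).2.
by have [y /xA] := omega_limit_nonempty f x; exists y.
Qed.


Lemma continuous_I01_val : continuous (@I01_val R).
Proof. exact: initial_continuous. Qed.

Lemma hausdorff_I01 : hausdorff_space (I01 R).
Proof.
move=> x y xy; apply: val_inj; apply: (@Rhausdorff R) => A B Ax By.
have [z [zA zB]] := xy _ _ (continuous_I01_val Ax) (continuous_I01_val By).
by exists (I01_val z).
Qed.

Lemma continuous_C01 f : continuous f.
Proof. exact: (@cts_fun _ _ f). Qed.

Lemma omega_limit_sub f x : omega_limit f x `<=` f @` omega_limit f x.
Proof.
move=> y xy; apply: contrapT => nfy.
pose P (um : I01 R * nat) (w : I01 R) := iter um.2 f x = w -> f w <> um.1.
have := (compact_near_coveringP [set: I01 R]).1 compact_I01 _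
  (filter_prod (nbhs y) \oo) P _.
case=> [z _|[U N] /= [yU [M _ NM]] UN].
  have [zx|/existsNP[N /not_implyP[_ /existsNP[W /not_implyP[zW WN]]]]] := pselect (omega_limit f x z).
    have fzy : f z != y by apply/eqP => fzy; apply: nfy; exists z.
    have := hausdorff_I01; rewrite open_hausdorff => /(_ _ _ fzy)[[A B]/= [/set_mem Az /set_mem By] [oA oB /eqP/seteqP[AB _]]].
    exists (f @^-1` A, B `*` setT).
      split => /=; first exact: (continuous_C01 (open_nbhs_nbhs (conj oA Az))).
      exists (B, setT); last by [].
      by split => /=; [exact: open_nbhs_nbhs|exact: filterT].
    by move=> [w [u m]] /= [Aw [Bu _]] _ wu; apply: (AB (f w)); split=> //; rewrite wu.
  exists (W, setT `*` [set m | (N <= m)%N]).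
    split => //=; exists (setT, [set m | (N <= m)%N]) => //=.
    by split; [exact: filterT|exists N].
  move=> [w [u m]] /= [Ww [_ Nm]] mw _; apply: WN; exists w; split => //.
  by exists m.
have [_ [[m /= Mm <-] Um]] := xy M.+1 I _ yU.
case: m Mm Um => // m Mm Um.
by apply: (UN (iter m.+1 f x, m) _ (iter m f x)) => //=; split=> //; exact: NM.
Qed.

Lemma omega_limit_image f x : f @` omega_limit f x `<=` omega_limit f x.
Proof.
move=> _ [y xy <-] n _ U /(@continuous_C01 f y) /(xy n I)[_ [[m /= nm <-] Um]].
exists (iter m.+1 f x); split => //; by exists m.+1 => //=; exact: leqW.
Qed.

Lemma milnor_attractor_closed f : closed (milnor_attractor f).
Proof. by case: (milnor_attractor_carries f). Qed.

Lemma milnor_attractor_sub f A :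
  carries_omega_limits f A -> milnor_attractor f `<=` A.
Proof. by move=> fA; apply: smallest_sub. Qed.

Lemma milnor_attractor_invariant f : f @` milnor_attractor f = milnor_attractor f.
Proof.
have [cL aL] := milnor_attractor_carries f.
apply/seteqP; split => [_ [y Ly <-]|].
  apply: (@milnor_attractor_sub f (f @^-1` milnor_attractor f) _ y Ly); split.
    by apply: preimage_closed => // ? _; exact: continuous_C01.
  apply: almost_allS aL => x xL y' xy'; apply: xL.
  by apply: omega_limit_image; exists y'.
apply: milnor_attractor_sub; split.
  apply: compact_closed; first exact: hausdorff_I01.
  apply: continuous_compact.
    by apply: continuous_subspaceT; exact: continuous_C01.
  exact: (subclosed_compact cL compact_I01).
apply: almost_allS aL => x xL y /omega_limit_sub[z /xL Lz <-].
by exists z.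
Qed.

Lemma frequency_ge0 f U n x : 0 <= frequency f U n x.
Proof. by rewrite mulr_ge0// sumr_ge0// => i _; rewrite indicE. Qed.

Lemma frequency_sub f U V n x : U `<=` V -> frequency f U n x <= frequency f V n x.
Proof.
move=> UV; rewrite ler_wpM2l// ler_sum// => i _; rewrite !indicE ler_nat.
case: (boolP (_ \in U)) => // /set_mem/UV ?; by rewrite mem_set.
Qed.

Lemma frequencyU f U V n x :
  frequency f (U `|` V) n x <= frequency f U n x + frequency f V n x.
Proof.
rewrite -mulrDr ler_wpM2l// -big_split/= ler_sum// => i _.
rewrite !indicE -natrD ler_nat in_setU.
by case: (_ \in U); case: (_ \in V).
Qed.

Lemma frequencyC f U n x : frequency f (~` U) n.+1 x = 1 - frequency f U n.+1 x.
Proof.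
apply/eqP; rewrite eq_sym subr_eq -mulrDr -big_split/=.
under eq_bigr => i _.
  rewrite (_ : _ + _ = 1); last first.
    by rewrite !indicE in_setC; case: (_ \in U); rewrite ?add0r ?addr0.
  over.
by rewrite sumr_const card_ord mulVf ?pnatr_eq0.
Qed.

Lemma cvg_frequencyC f U x (l : R) :
  frequency f U n x @[n --> \oo] --> l ->
  frequency f (~` U) n x @[n --> \oo] --> 1 - l.
Proof.
rewrite -(cvg_shiftn 1%N) => Ul; rewrite -(cvg_shiftn 1%N)/=.
under eq_fun => n do rewrite addn1 frequencyC -addn1.
by apply: cvgB => //; exact: cvg_cst.
Qed.

Definition sparse f U := almost_all (fun x => frequency f U n x @[n --> \oo] --> (0 : R)).

Lemma sparseS f U V : U `<=` V -> sparse f V -> sparse f U.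
Proof.
move=> UV; apply: almost_allS => x Vx.
apply: (squeeze_cvgr _ (cvg_cst 0) Vx).
by apply: nearW => n; rewrite frequency_ge0 frequency_sub.
Qed.

Lemma sparseU f U V : sparse f U -> sparse f V -> sparse f (U `|` V).
Proof.
move=> sU sV; apply: almost_allS (almost_all_and sU sV) => x [Ux Vx].
have UVx : frequency f U n x + frequency f V n x @[n --> \oo] --> (0 : R).
  by rewrite -[X in _ --> X]addr0; exact: cvgD.
apply: (squeeze_cvgr _ (cvg_cst 0) UVx).
by apply: nearW => n; rewrite frequency_ge0 frequencyU.
Qed.

Lemma sparse0 f : sparse f set0.
Proof.
apply: almost_allW => x.
rewrite (_ : (fun n => _) = cst 0); first exact: cvg_cst.
apply/funext => n; rewrite /frequency big1 ?mulr0// => i _.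
by rewrite indicE in_set0.
Qed.

Lemma attracts_statisticallyP f A : closed A ->
  attracts_statistically f A <->
  forall y, ~ A y -> exists2 V, nbhs y V & sparse f V.
Proof.
move=> cA; split => [[_ aA] y nAy|As].
  have /nbhs_ballP[e /= e0 eA] : nbhs y (~` A).
    by apply: open_nbhs_nbhs; split => //; exact/closed_openC.
  exists (ball y (e / 2)); first by apply: nbhsx_ballx; rewrite divr_gt0.
  have /aA : A `<=` interior (~` ball y (e / 2)).
    move=> a Aa; apply/nbhs_ballP; exists (e / 2); first by rewrite /= divr_gt0.
    by move=> z az yz; apply: (eA a) => //; exact: (ball_split yz (ball_sym az)).
  move=> aU; apply: almost_allS aU => x /cvg_frequencyC.
  by rewrite setCK subrr.
split=> // U AU.
have /choice[V Vs] : forall y, exists V, ~ A y -> nbhs y V /\ sparse f V.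
  move=> y; have [Ay|/As[V yV sV]] := pselect (A y); first by exists set0.
  by exists V.
have : compact (~` interior U).
  apply: (subclosed_compact _ compact_I01) => //.
  by apply: open_closedC; exact: open_interior.
rewrite compact_cover => /(_ (I01 R) (~` interior U) (interior \o V)).
have nA y : ~ interior U y -> ~ A y by move=> ? /AU.
case => [y _|y nUy|D' D'U UD'].
- exact: open_interior.
- by exists y => //; have [] := Vs _ (nA _ nUy).
have sU : sparse f (~` U).
  have UV : ~` U `<=` \big[setU/set0]_(y <- finmap.enum_fset D') V y.
    move=> y nUy; rewrite -bigcup_seq.
    have [|z /= zD' zy] := UD' y; first by move/interior_subset.
    by exists z => //; exact: interior_subset zy.
  apply: (sparseS UV).
  rewrite big_seq; elim/big_ind : _ => [||y /D'U]; [exact: sparse0|exact: sparseU|].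
  by move=> /set_mem/nA/Vs[].
apply: almost_allS sU => x /cvg_frequencyC; by rewrite setCK subr0.
Qed.

Lemma stat_attractor_attracts f : attracts_statistically f (stat_attractor f).
Proof.
have cA : closed (stat_attractor f) by apply: closed_bigI => A [[]].
apply/attracts_statisticallyP => // y /existsNP[A /not_implyP[[[cA' aA] _] nAy]].
exact: (attracts_statisticallyP f cA').1.
Qed.

End attractors.

Definition borel01 (R : realType) := g_sigma_algebraType (@open (I01 R)).

Section measures.
Context {R : realType}.

Definition weak_star_cvg (m : nat -> {measure set (borel01 R) -> \bar R})
    (mu : {measure set (borel01 R) -> \bar R}) :=
  forall phi : I01 R -> R, continuous phi ->
    (\int[m n]_x (phi x)%:E @[n --> \oo] --> \int[mu]_x (phi x)%:E)%E.

Definition empirical (f : C01 R) (x : I01 R) (n : nat) :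
    {measure set (borel01 R) -> \bar R} :=
  mscale (n%:R^-1)%:nng (msum (fun i => \d_(iter i f x : borel01 R)) n).

Definition invariant_measure (f : C01 R) (mu : probability (borel01 R) R) :=
  forall A : set (borel01 R), measurable A -> mu (f @^-1` A) = mu A.

Definition basin (f : C01 R) (mu : probability (borel01 R) R) : set (I01 R) :=
  [set x | weak_star_cvg (empirical f x) mu].

End measures.

(* Main.v *)
Require Import Defs.
From mathcomp Require Import all_boot all_order all_algebra.
From mathcomp Require Import all_classical all_reals all_analysis.
From mathcomp Require Import borel_hierarchy measurable_realfun lra ring.

Set Implicit Arguments.
Unset Strict Implicit.
Unset Printing Implicit Defensive.

Import Order.TTheory GRing.Theory Num.Theory.
Import numFieldNormedType.Exports.

Local Open Scope classical_set_scope.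
Local Open Scope ring_scope.

(** Everything rests on one perturbation.  Cut the interval into N blocks, every
    block into M cells, and shrink every cell to a core of radius rho about its
    midpoint.  Any map f is uniformly close to a map g that is constant on each
    core, with the midpoint of another cell as its value: block i is sent to a
    block tau i near the image of block i under f, and the a-th cell of block i
    to the a-th cell of block tau i, so that g carries M independent copies of
    the finite map tau.  In the gaps between the cores g interpolates, which
    keeps it close to f by convexity.  A map h close enough to g still sends
    each core into the delta-neighborhood of a midpoint with delta < rho, so h
    moves the cores as tau prescribes.  Nothing is known of h on the gaps,
    but rho and delta are chosen after N and M, so the gaps and the
    delta-neighborhoods are as short as one likes relative to their number.
    This control of h is [grid_dynamics].

    If x is a non-wandering point of f, then a point near x that returns near x
    traces a closed walk of blocks through the block of x; a simple cycle
    extracted from it lets tau be periodic at that block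
    ([cycle_map_through], [coarse_grid]).  Hence g can be found near f
    with [grid_dynamics] robustly valid and a periodic block inside a given
    neighborhood of x ([gridded_dense]).  For such h:
    - every core of the periodic block is a trap, an interval mapped into
      itself by an iterate of h, and there are two disjoint ones
      ([gridded_traps]);
    - a non-wandering point of h lies in a gap or within delta of a midpoint,
      which covers Omega h by 2NM + 1 tiny intervals ([grid_Omega_cover]);
    - orbits that start in different copies stay in different copies, which a
      fixed continuous function detects; a basin therefore meets the cores of
      one copy only, and the copies are many, so it has small measure
      ([gridded_basin]);
    - two adjacent cores of the periodic block are separated by an upward
      crossing of the diagonal by an iterate of h ([grid_crossing]).

    Call f generic if for every rational ball U and every m either all maps near
    f are controlled in this way, with a periodic block in U and fineness m, or
    no map near f has a non-wandering point in U.  These conditions are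
    open, and dense by the perturbation ([decided_dense]).  So for generic f
    each non-wandering point is approximated by traps that persist under
    perturbation of f, and each wandering point has a neighborhood that is free
    of non-wandering points for all maps near f.

    A trap meets the omega-limit set of each of its points, it has positive
    measure, and orbits in it return to it with positive frequency, so Omega f
    is contained in all three attractors; conversely a wandering neighborhood
    is visited at most once by each orbit.  Two disjoint traps in each neighborhood make
    Omega f perfect, the fine coverings give dimension zero and total
    disconnectedness, and the persistence of both alternatives gives
    robustness by compactness.  Lastly, let q be the last fixed
    point of the iterate before an upward crossing: points to the right of q
    are pushed to the right, whereas stability, applied to the complement
    of a point z outside Omega f between q and the crossing, would keep
    the orbits of points near q below z ([crossing_not_stable]). *)

(** * Points of the unit interval and wandering sets *)

Local Notation rv := I01_val.

Section interval.
Context {R : realType}.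
Implicit Types (x y : I01 R) (U : set (I01 R)) (r : R).

Lemma rv_itv x : 0 <= rv x <= 1.
Proof. by have /set_mem := valP x; rewrite /= in_itv. Qed.

Lemma rv_inj : injective (@I01_val R).
Proof. exact: val_inj. Qed.

Lemma clamp_itv r : Num.max 0 (Num.min 1 r) \in (`[0, 1]%classic : set R).
Proof.
by rewrite inE /= in_itv /= le_max lexx /= ge_max ler01 ge_min lexx.
Qed.

(** The retraction of the line onto the unit interval, used to pass from
    real numbers to points and to view self-maps of the interval as real
    functions. *)
Definition clamp r : I01 R := exist _ (Num.max 0 (Num.min 1 r)) (clamp_itv r).

Lemma clampK r : 0 <= r <= 1 -> rv (clamp r) = r.
Proof.
by move=> /andP[r0 r1]; rewrite /I01_val /= set_valE /= min_r // max_r.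
Qed.

Lemma clampE r : rv (clamp r) = if r <= 0 then 0 else if 1 <= r then 1 else r.
Proof.
rewrite /I01_val /= set_valE /=; case: (leP 1 r) => r1; case: (leP r 0) => r0 //.
- by have := lt_le_trans ltr01 (le_trans r1 r0); rewrite ltxx.
- by rewrite max_r.
Qed.

Lemma clamp_val x : clamp (rv x) = x.
Proof. by apply: rv_inj; rewrite clampK// rv_itv. Qed.

Lemma nbhs_I01P x U :
  nbhs x U <-> exists2 e : R, 0 < e & forall y, `|rv x - rv y| < e -> U y.
Proof.
split=> [/nbhs_ballP[e e0 eU]|[e e0 eU]]; first by exists e.
by apply/nbhs_ballP; exists e.
Qed.

Lemma continuous_clamp : continuous clamp.
Proof.
move=> r U /nbhs_I01P[e e0 eU].
apply/nbhs_ballP; exists e => //= s; rewrite /ball/= => rs; apply: eU.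
apply: le_lt_trans rs; rewrite !clampE.
have := ler_norm (r - s); have := ler_norm (s - r).
rewrite [in X in X -> _]distrC ler_norml.
case: (leP r 0) => ?; case: (leP 1 r) => ?;
  case: (leP s 0) => ?; case: (leP 1 s) => ?; lra.
Qed.

Lemma continuous_iter (f : C01 R) n : continuous (iter n f).
Proof.
elim: n => [|n IHn] x; first exact: cvg_id.
by apply: continuous_comp (IHn x) _; exact: continuous_C01.
Qed.

End interval.

Section generalities.
Context {R : realType}.
Implicit Types (f : C01 R) (x y : I01 R) (U V W A : set (I01 R)).

Lemma Omega_closed f : closed (Omega f).
Proof.
move=> x clx U Ux.
have [y [Oy Uy]] : Omega f `&` interior U !=set0.
  by apply: clx; exact: (nbhs_interior Ux).
have [n n0 [z [[w Vw <-] Vz]]] := Oy _ (open_nbhs_nbhs (conj (@open_interior _ U) Uy)).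
by exists n => //; exists (iter n f w); split; [exists w => //|]; exact: interior_subset.
Qed.

(** An omega-limit point is visited infinitely often by one orbit, and two such
    visits make a return. *)
Lemma omega_limit_Omega f x : omega_limit f x `<=` Omega f.
Proof.
move=> y xy U yU.
have [_ [[m _ <-] Um]] := xy 0%N I U yU.
have [_ [[n /= mn <-] Un]] := xy m.+1 I U yU.
exists (n - m)%N; first by rewrite subn_gt0.
exists (iter n f x); split=> //; exists (iter m f x) => //.
by rewrite -iterD subnK// ltnW.
Qed.

Lemma Omega_nonempty f : Omega f !=set0.
Proof.
by have [y /omega_limit_Omega] := omega_limit_nonempty f point; exists y.
Qed.

Lemma periodic_Omega f n x : (0 < n)%N -> iter n f x = x -> Omega f x.
Proof.
move=> n0 fx U Ux; exists n => //; exists x; split; last exact: nbhs_singleton.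
by exists x => //; exact: nbhs_singleton.
Qed.

Lemma milnor_sub_Omega f : milnor_attractor f `<=` Omega f.
Proof.
apply: milnor_attractor_sub; split; first exact: Omega_closed.
by apply: almost_allW => x; exact: omega_limit_Omega.
Qed.

Definition wandering f U :=
  forall n, (0 < n)%N -> (iter n f @` U) `&` U = set0.

Lemma not_Omega_wandering f x :
  ~ Omega f x -> exists2 U, open_nbhs x U & wandering f U.
Proof.
move=> /existsNP[U /not_implyP[xU nU]].
exists (interior U); first by split; [exact: open_interior|exact: xU].
move=> n n0; apply/seteqP; split => // z [[w Vw <-] Vz]; apply: nU.
exists n => //; exists (iter n f w); split; [exists w => //|]; exact: interior_subset.
Qed.

(** Two visits of one orbit to U would exhibit a return of U to itself, so an
    orbit visits a wandering set at most once. *)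
Lemma wandering_frequency f U n x : wandering f U -> frequency f U n x <= n%:R^-1.
Proof.
move=> wU; rewrite -[leRHS]mulr1 ler_wpM2l//.
have [|] := pselect (exists k : 'I_n, U (iter k f x)); last first.
  move=> nk; rewrite big1// => k _; rewrite indicE memNset// => Uk.
  by apply: nk; exists k.
move=> [k Uk]; rewrite (bigD1 k)//= big1 ?addr0 ?indicE ?mem_set//.
move=> j jk; rewrite indicE memNset// => Uj.
wlog jk' : j k Uk Uj jk / (j < k)%N.
  move=> H; have : (j != k :> nat) by [].
  rewrite neq_ltn => /orP[]; first exact: H Uj jk.
  by apply: H Uk _ => //; rewrite eq_sym.
have : ((iter (k - j)%N f @` U) `&` U) (iter k f x).
  by split=> //; exists (iter j f x) => //; rewrite -iterD subnK// ltnW.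
by rewrite wU// subn_gt0.
Qed.

Lemma cvg_harmonic_inv : (fun n => n%:R^-1 : R) @ \oo --> (0 : R).
Proof.
rewrite -(cvg_shiftn 1%N); have := @cvg_harmonic R; rewrite /harmonic.
by under eq_fun do rewrite -addn1.
Qed.

(** A wandering neighborhood is visited at most once, hence with frequency
    tending to zero. *)
Lemma stat_sub_Omega f : stat_attractor f `<=` Omega f.
Proof.
apply: smallest_sub => //; apply/attracts_statisticallyP; first exact: Omega_closed.
move=> y /not_Omega_wandering[U yU wU]; exists U; first exact: open_nbhs_nbhs.
apply: almost_allW => x; apply: (squeeze_cvgr _ (cvg_cst 0) cvg_harmonic_inv).
by apply: nearW => n; rewrite frequency_ge0 wandering_frequency.
Qed.

Lemma lam_set0 : lam (set0 : set (I01 R)) = 0%E.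
Proof. by rewrite /lam image_set0 measure0. Qed.

(** Frequencies of visits to a wandering neighborhood tend to zero uniformly in
    the initial point, so the neighborhood is not essential. *)
Lemma phys_sub_Omega f : phys_attractor f `<=` Omega f.
Proof.
move=> y yA; apply: contrapT => /not_Omega_wandering[U [oU Uy] wU].
apply: yA; exists U => //; split=> // -[_ [k [k0 koo [e [d [e0 d0 H]]]]]].
have : \forall n \near \oo, (n%:R^-1 : R) < e.
  by apply: (cvgr_lt _ cvg_harmonic_inv).
move=> /koo [N _ /(_ N (leqnn N)) /= Ne].
have := H N; rewrite (_ : [set x | _] = set0) ?lam_set0 ?lte_fin.
  by rewrite ltNge ltW.
apply/seteqP; split => // x /=; rewrite ltNge; move/negP; apply.
by rewrite (le_trans (wandering_frequency _ _ wU))// ltW.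
Qed.

End generalities.

(** * Traps and attractors *)

Section traps.
Context {R : realType}.
Implicit Types (f : C01 R) (x y : I01 R) (U V W A : set (I01 R)).

Definition cball (c r : R) : set (I01 R) := [set x | `|rv x - c| <= r].

Lemma lamS A B : A `<=` B -> (lam A <= lam B)%E.
Proof. by move=> AB; apply: le_outer_measure; exact: image_subset. Qed.

Lemma lam_cball c r : 0 <= c - r -> c + r <= 1 -> 0 <= r ->
  lam (cball c r) = (r *+ 2)%:E.
Proof.
move=> cr0 cr1 r0; have -> : lam (cball c r) = lebesgue_measure `[c - r, c + r]%classic.
  congr (lebesgue_measure _); apply/seteqP; split=> s /=.
    by move=> [x /= xc <-]; rewrite in_itv/= -ler_distlC distrC.
  rewrite in_itv/= => /andP[s0 s1]; have s01 : 0 <= s <= 1 by apply/andP; split; lra.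
  by exists (clamp s); rewrite ?clampK//= /cball/= clampK// distrC ler_distlC s0.
rewrite lebesgue_measure_itv/= lte_fin; case: ltP => [_|rr].
  by rewrite -EFinB; congr EFin; rewrite mulr2n; ring.
by congr EFin; rewrite mulr2n; lra.
Qed.

(** The outer measure is used so that A need not be measurable. *)
Lemma lam_cover A n (p w : nat -> R) : (forall j, 0 <= w j) ->
  A `<=` \bigcup_(j in `I_n) cball (p j) (w j) ->
  (lam A <= (\sum_(j < n) w j *+ 2)%:E)%E.
Proof.
move=> w0 Aw; pose F j : set R := `[p j - w j, p j + w j]%classic.
have /le_trans : (lam A <= lebesgue_measure (\big[setU/set0]_(j < n) F j))%E.
  apply: le_outer_measure => _ [x /Aw[j /= jn xj] <-].
  rewrite -bigcup_mkord; exists j => //.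
  by rewrite /F/= in_itv/= -ler_distlC distrC.
apply; apply: le_trans (outer_measure_subadditive _ _ _) _.
rewrite -sumEFin; apply: lee_sum => j _.
rewrite [leLHS](_ : _ = lebesgue_measure (F j))//.
rewrite lebesgue_measure_itv/= lte_fin; case: ltP => [_|rr].
  by rewrite -EFinB lee_fin mulr2n; have := w0 j; lra.
by rewrite lee_fin mulr2n; have := w0 j; lra.
Qed.

Lemma almost_all_meets (P : I01 R -> Prop) W :
  almost_all P -> (0 < lam W)%E -> exists2 x, W x & P x.
Proof.
move=> [B [mB B0 PB]] W0; apply: contrapT => nWP.
suff : (lam W <= 0)%E by rewrite leNgt W0.
rewrite -B0; apply: le_outer_measure => _ [x Wx <-]; apply: PB.
by exists x => // Px; apply: nWP; exists x.
Qed.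

(** A closed set of positive measure that some iterate maps into itself.  The
    lower bound d on the measure is kept explicit because it serves as the
    constant delta of an essential set. *)
Definition trap f W := [/\ closed W, exists2 d : R, 0 < d & (d%:E < lam W)%E
  & exists2 n, (0 < n)%N & iter n f @` W `<=` W].

Lemma iter_trap f n W k x : iter n f @` W `<=` W -> W x -> W (iter (k * n) f x).
Proof.
move=> fW Wx; elim: k => [//|k IHk]; rewrite mulSn iterD.
by apply: fW; exists (iter (k * n) f x).
Qed.

(** The iterates at multiples of the return time stay in the compact set W and
    so accumulate there. *)
Lemma omega_limit_trap f W x : trap f W -> W x -> omega_limit f x `&` W !=set0.
Proof.
move=> [cW _ [n n0 fW]] Wx.
have [|y [Wy cy]] := (subclosed_compact cW compact_I01 (@subsetT _ _))
  ((fun k => iter (k * n) f x) @ \oo) _.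
  by apply: (@filterE _ \oo) => k; exact: iter_trap.
exists y; split=> // N _ U Uy.
have [|z [zA Uz]] := cy [set iter m f x | m in [set m | (N <= m)%N]] U _ Uy.
  exists N => // k /= Nk; exists (k * n)%N => //=.
  by rewrite (leq_trans Nk)// leq_pmulr.
by exists z.
Qed.

Lemma trap_lam_gt0 f W : trap f W -> (0 < lam W)%E.
Proof. by move=> [_ [d d0 dW] _]; rewrite (lt_trans _ dW)// lte_fin. Qed.

Lemma trap_milnor f W : trap f W -> milnor_attractor f `&` W !=set0.
Proof.
move=> tW; have [x Wx xL] := almost_all_meets
  (milnor_attractor_carries f).2 (trap_lam_gt0 tW).
by have [y [/xL Ly Wy]] := omega_limit_trap tW Wx; exists y.
Qed.

(** The number of multiples of n below k, which counts the visits to a trap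
    that are guaranteed by periodicity. *)
Lemma sum_dvdn n k : (0 < n)%N -> (\sum_(i < k) (n %| i) = (k + n.-1) %/ n)%N.
Proof.
move=> n0; elim: k => [|k IHk]; first by rewrite big_ord0 divn_small// prednK.
rewrite big_ord_recr/= IHk addSnnS prednK// -[in RHS](prednK n0) addnS divnS ?prednK//.
by rewrite -addnS prednK// dvdn_addl// addnC.
Qed.

Lemma trap_frequency f W n : (0 < n)%N -> iter n f @` W `<=` W ->
  forall V k x, W `<=` V -> W x -> n%:R^-1 <= frequency f V k.+1 x.
Proof.
move=> n0 fW V k x WV Wx.
rewrite /frequency -ler_pdivrMl ?invr_gt0//.
rewrite invrK -ler_pdivlMr ?invr_gt0 ?ltr0n// invrK.
apply: (@le_trans _ _ ((\sum_(i < k.+1) (n %| i))%N%:R * n%:R)).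
  rewrite -natrM ler_nat sum_dvdn// -(leq_add2l n.-1) addnC.
  by rewrite -ltnS -[X in (_ < X)%N]addSn prednK// -mulSn ltn_ceil.
rewrite ler_wpM2r// natr_sum ler_sum// => i _.
rewrite indicE ler_nat; case: dvdnP => // -[j ->].
by rewrite mem_set//; apply: WV; exact: iter_trap.
Qed.

Lemma trap_essential f W V : trap f W -> W `<=` V -> open V -> essential f V.
Proof.
move=> [cW [d d0 dW] [n n0 fW]] WV oV; split=> //; exists (addn^~ 1%N); split=> [k||].
- by rewrite addn1.
- exact: cvg_addnr.
(* The halving turns the bound n^-1 on the frequency into a strict one. *)
exists (n%:R^-1 / 2), d; split=> //; first by rewrite divr_gt0// invr_gt0 ltr0n.
move=> k; apply: (lt_le_trans dW); rewrite addn1; apply: lamS => x Wx /=.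
apply: lt_le_trans (trap_frequency n0 fW k WV Wx).
by rewrite ltr_pdivrMr// ltr_pMr ?invr_gt0 ?ltr0n// ltr1n.
Qed.

Lemma trap_not_sparse f W V : trap f W -> W `<=` V -> ~ sparse f V.
Proof.
move=> tW WV /almost_all_meets -/(_ _ (trap_lam_gt0 tW))[x Wx x0].
have [_ _ [n n0 fW]] := tW.
have : \forall k \near \oo, frequency f V k x < n%:R^-1.
  by apply: (cvgr_lt _ x0); rewrite invr_gt0 ltr0n.
move=> [N _ /(_ N.+1 (leqnSn _)) /=].
by rewrite ltNge (trap_frequency n0 fW N WV Wx).
Qed.

(** The property of generic maps from which the equality of the attractors
    is derived. *)
Definition trapping f := forall x U, Omega f x -> nbhs x U ->
  exists2 W, trap f W & W `<=` U.

Lemma Omega_sub_phys f : trapping f -> Omega f `<=` phys_attractor f.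
Proof.
move=> tf x Ox [U [oU nU] Ux].
have [W tW WU] := tf x U Ox (open_nbhs_nbhs (conj oU Ux)).
by apply: nU; exact: trap_essential tW WU oU.
Qed.

Lemma Omega_sub_stat f : trapping f -> Omega f `<=` stat_attractor f.
Proof.
move=> tf x Ox; apply: contrapT => nx.
have [cA _] := stat_attractor_attracts f.
have [U Ux sU] := (attracts_statisticallyP f cA).1 (stat_attractor_attracts f) x nx.
by have [W tW WU] := tf x U Ox Ux; exact: trap_not_sparse tW WU sU.
Qed.

Lemma Omega_sub_milnor f : trapping f -> Omega f `<=` milnor_attractor f.
Proof.
move=> tf x Ox; apply: milnor_attractor_closed => U Ux.
have [W /trap_milnor[y [Ly Wy]] WU] := tf x U Ox Ux.
by exists y; split=> //; exact: WU.
Qed.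

End traps.

(** * Choosing the finite map *)

(** A closed walk through i0 contains a simple cycle through i0.  Following
    its successor function on the cycle and any edge elsewhere gives a map tau
    inside e for which i0 is periodic; simplicity is what makes the successor
    well defined. *)
Lemma cycle_map_through (T : finType) (e : rel T) (i0 i1 : T) :
  (forall i, exists j, e i j) -> e i0 i1 -> connect e i1 i0 ->
  exists2 tau : T -> T, (forall i, e i (tau i)) &
    exists2 n, (0 < n)%N & iter n tau i0 = i0.
Proof.
move=> etot ei /connectP[s0 es0]; case/shortenP: es0 => s es us _ si0.
pose c := i1 :: s.
have cc : cycle e c by rewrite /c /= rcons_path es -si0.
have ic : i0 \in c by rewrite si0 mem_last.
pose tau i := if i \in c then next c i else odflt i [pick j | e i j].
exists tau => [i|].
  rewrite /tau; case: ifPn => [/next_cycle|_]; first exact.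
  by case: pickP => //= ne; have [j] := etot i; rewrite ne.
have ct : fcycle tau c.
  rewrite -(@eq_in_cycle _ (mem c) (frel (next c))) ?cycle_next//; last exact/allP.
  by move=> i j ci _ /=; rewrite /tau ci.
exists (order tau i0); first exact: order_gt0.
exact: (iter_order_in (mem_fcycle ct) (inj_cycle ct)).
Qed.

Section grid.
Context {R : realType}.
Implicit Types (f : C01 R) (x y : I01 R) (U : set (I01 R)).

(** Compactness, in the form of the near-covering property for d tending to 0. *)
Lemma unif_cont f (e : R) : 0 < e -> exists2 d : R, 0 < d &
  forall x y, `|rv x - rv y| < d -> `|rv (f x) - rv (f y)| < e.
Proof.
move=> e0; pose P (d : R) x := forall y, `|rv x - rv y| < d -> `|rv (f x) - rv (f y)| < e.
have H : \forall d \near 0^'+, [set: I01 R] `<=` P d.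
  apply: (compact_near_coveringP _).1 compact_I01 _ _ _ _ _ => x _.
  have /nbhs_I01P[d d0 dE] : nbhs x [set z | `|rv (f x) - rv (f z)| < e / 2].
    apply: (@continuous_C01 R f x [set w | `|rv (f x) - rv w| < e / 2]).
    by apply/nbhs_I01P; exists (e / 2) => //; rewrite divr_gt0.
  have d20 : 0 < d / 2 by rewrite divr_gt0.
  exists ([set z | `|rv x - rv z| < d / 2], [set r : R | r < d / 2]).
    split; first by apply/nbhs_I01P; exists (d / 2).
    exact: nbhs_right_lt.
  move=> [z r] /= [xz rd] y zy.
  have xy : `|rv x - rv y| < d.
    by rewrite (le_lt_trans (ler_distD (rv z) _ _))// (splitr d) ltrD// (lt_trans zy).
  have xz' : `|rv x - rv z| < d by rewrite (lt_trans xz)// ltr_pdivrMr// ltr_pMr// ltr1n.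
  rewrite (le_lt_trans (ler_distD (rv (f x)) _ _))// (splitr e) ltrD//.
    by rewrite distrC; exact: dE.
  exact: dE.
have [d /= [d0 dP]] : exists d : R, 0 < d /\ [set: I01 R] `<=` P d.
  have [d] := filter_ex (filterI (@nbhs_right_gt R 0) H).
  by move=> [d0 dP]; exists d.
by exists d => // x y; exact: dP.
Qed.

Definition mid (L k : nat) : R := (k%:R + 2^-1) / L%:R.

Lemma mid_sep L j k : (0 < L)%N -> j != k -> L%:R^-1 <= `|mid L j - mid L k|.
Proof.
move=> L0 jk; rewrite /mid -mulrBl opprD addrACA subrr addr0.
rewrite normrM [X in _ * X]ger0_norm ?invr_ge0// ler_peMl ?invr_ge0//.
wlog jk' : j k jk / (k < j)%N.
  move=> H; move: (jk); rewrite neq_ltn => /orP[|]; last exact: H.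
  by rewrite distrC; apply: H; rewrite eq_sym.
rewrite -natrB ?(ltnW jk')// ger0_norm// -[leLHS]/(1%:R) ler_nat.
by rewrite subn_gt0.
Qed.

Lemma mid_cover L (r : R) : (0 < L)%N -> 0 <= r <= 1 ->
  exists k : 'I_L, `|r - mid L k| <= L%:R^-1 / 2.
Proof.
case: L => // L _ /andP[r0 r1].
have L0 : 0 < L.+1%:R :> R by rewrite ltr0n.
have [k kL [k0 k1]] : exists2 k, (k < L.+1)%N &
    k%:R <= r * L.+1%:R /\ r * L.+1%:R <= k.+1%:R.
  have /truncn_itv/andP[k0 k1] : 0 <= r * L.+1%:R by rewrite mulr_ge0.
  have [kL|kL] := ltnP (Num.truncn (r * L.+1%:R)) L.+1.
    by exists (Num.truncn (r * L.+1%:R)) => //; split=> //; exact: ltW.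
  exists L => //; split; last by rewrite ler_piMl.
  by apply: le_trans k0; rewrite ler_nat ltnW.
exists (Ordinal kL).
have mL : mid L.+1 (Ordinal kL) * L.+1%:R = k%:R + 2^-1 by rewrite /mid divfK ?gt_eqF.
have dL : L.+1%:R^-1 / 2 * L.+1%:R = 2^-1 :> R by field; rewrite gt_eqF.
rewrite ler_distlC -(ler_pM2r L0) -[X in _ && X](ler_pM2r L0).
rewrite mulrBl mulrDl mL dL; move: k1; rewrite -natr1 => k1.
by apply/andP; split; lra.
Qed.

(** The bound is attained by the two extreme cells of the block. *)
Lemma mid_refine N M i a : (0 < N)%N -> (a < M)%N ->
  `|mid (N * M) (i * M + a) - mid N i| <= N%:R^-1 / 2 - (N * M)%:R^-1 / 2.
Proof.
move=> N0 aM; have M0 : (0 < M)%N by apply: leq_ltn_trans aM.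
have N0' : 0 < N%:R :> R by rewrite ltr0n.
have M0' : 0 < M%:R :> R by rewrite ltr0n.
have -> : mid (N * M) (i * M + a) - mid N i =
   (a%:R + 2^-1 - M%:R / 2) / (N%:R * M%:R) :> R.
  by rewrite /mid natrM natrD natrM; field; rewrite !gt_eqF.
have -> : N%:R^-1 / 2 - (N * M)%:R^-1 / 2 = (M%:R / 2 - 2^-1) / (N%:R * M%:R) :> R.
  by rewrite natrM; field; rewrite !gt_eqF.
rewrite normrM [X in _ * X]gtr0_norm ?invr_gt0 ?mulr_gt0// ler_pM2r ?invr_gt0 ?mulr_gt0//.
move: aM; rewrite -(ler_nat R) -natr1 => aM; have : 0 <= a%:R :> R by [].
by rewrite ler_norml => a0; apply/andP; split; lra.
Qed.

Lemma mid_itv L k : (k < L)%N -> L%:R^-1 / 2 <= mid L k <= 1 - L%:R^-1 / 2.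
Proof.
move=> kL; have L0 : 0 < L%:R :> R by rewrite ltr0n (leq_ltn_trans _ kL).
have mL : mid L k * L%:R = k%:R + 2^-1 by rewrite /mid divfK ?gt_eqF.
have dL : L%:R^-1 / 2 * L%:R = 2^-1 :> R by field; rewrite gt_eqF.
rewrite -(ler_pM2r L0) -[X in _ && X](ler_pM2r L0) mulrBl mL dL mul1r.
move: kL; rewrite -(ler_nat R) -natr1 => kL; have : 0 <= k%:R :> R by [].
by move=> k0; apply/andP; split; lra.
Qed.

(** The orbit of y is followed through the blocks nearest to its points. *)
Lemma orbit_connect f N (e : rel 'I_N) n y (i j : 'I_N) :
  (0 < N)%N -> (0 < n)%N ->
  (forall (i j : 'I_N) y, `|rv y - mid N i| <= N%:R^-1 ->
    `|rv (f y) - mid N j| <= N%:R^-1 -> e i j) ->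
  `|rv y - mid N i| <= N%:R^-1 -> `|rv (iter n f y) - mid N j| <= N%:R^-1 ->
  exists2 i1, e i i1 & connect e i1 j.
Proof.
move=> N0 n0 eP; case: n n0 => // n _.
elim: n y i => [|n IHn] y i yi yj; first by exists j => //; exact: eP yi yj.
have [k fk] := mid_cover N0 (rv_itv (f y)).
have fk' : `|rv (f y) - mid N k| <= N%:R^-1.
  by rewrite (le_trans fk)// ler_pdivrMr// ler_peMr ?invr_ge0// ler1n.
have [|k1 kk1 k1j] := IHn (f y) k fk'; first by rewrite -iterSr.
by exists k; [exact: eP fk'|exact: connect_trans (connect1 kk1) k1j].
Qed.

(** The graph of admissible transitions joins i to j if some point near block i
    is mapped near block j, with a slack of half a block on both sides.  Blocks are
    shorter than the modulus of continuity of f, so any map inside this graph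
    shadows f.  The slack makes an approximate return to x a closed
    walk through the block of x itself. *)
Lemma coarse_grid f (e : R) x U : 0 < e -> Omega f x -> nbhs x U ->
  exists N, [/\ (0 < N)%N, N%:R^-1 < e & exists tau : 'I_N -> 'I_N,
   (forall (i : 'I_N) y, `|rv y - mid N i| <= N%:R^-1 ->
      `|rv (f y) - mid N (tau i)| < e) /\
   exists i0 : 'I_N, (forall y, `|rv y - mid N i0| <= N%:R^-1 -> U y) /\
   exists2 n, (0 < n)%N & iter n tau i0 = i0].
Proof.
move=> e0 Ox /nbhs_I01P[r r0 rU].
have e20 : 0 < e / 2 by rewrite divr_gt0.
have [d d0 dE] := unif_cont f e20.
(* Blocks have to be small for the accuracy e, for the modulus of continuity,
   and for the block of x to lie in U. *)
pose z := Num.min (e / 2) (Num.min (d / 2) (r / 2)).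
have z0 : 0 < z by rewrite /z !lt_min !divr_gt0.
have [N' _ /(_ N' (leqnn N')) /= Nz] := near_infty_natSinv_lt (PosNum z0).
pose N := N'.+1; rewrite -/N in Nz.
have N0 : 0 < N%:R^-1 :> R by rewrite invr_gt0 ltr0n.
move: Nz; rewrite /z !lt_min => /and3P[Ne Nd Nr].
exists N; split=> //; first by rewrite (lt_trans Ne)// ltr_pdivrMr// ltr_pMr// ltr1n.
pose ee (i j : 'I_N) := `[< exists y,
  `|rv y - mid N i| <= N%:R^-1 /\ `|rv (f y) - mid N j| <= N%:R^-1 >].
have half_le (s : R) : s <= N%:R^-1 / 2 -> s <= N%:R^-1 by move=> ?; lra.
have [i0 xi0] := @mid_cover N _ isT (rv_itv x).
have [n n0 [_ [[y xy <-] xfy]]] : exists2 n, (0 < n)%N &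
    (iter n f @` [set y | `|rv x - rv y| < N%:R^-1 / 2]) `&`
    [set y | `|rv x - rv y| < N%:R^-1 / 2] !=set0.
  by apply: Ox; apply/nbhs_I01P; exists (N%:R^-1 / 2) => //; rewrite divr_gt0.
have [i1 ei1 i1i0] : exists2 i1, ee i0 i1 & connect ee i1 i0.
  apply: (@orbit_connect f N ee n y) => //.
  - by move=> i j w wi wj; apply/asboolP; exists w.
  - rewrite (le_trans (ler_distD (rv x) _ _))// (splitr N%:R^-1) lerD// distrC.
    exact: ltW.
  - rewrite (le_trans (ler_distD (rv x) _ _))// (splitr N%:R^-1) lerD// distrC.
    exact: ltW.
have [|tau tauP [p p0 pi0]] := cycle_map_through _ ei1 i1i0.
  move=> i; pose w : I01 R := clamp (mid N i).
  have [j wj] := @mid_cover N _ isT (rv_itv (f w)).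
  exists j; apply/asboolP; exists w; split; last exact: half_le.
  have /andP[m0 m1] := mid_itv (ltn_ord i).
  rewrite clampK ?subrr ?normr0; first exact: ltW.
  by apply/andP; split; lra.
exists tau; split.
  move=> i y' yi; have /asboolP[w [wi fw]] := tauP i.
  rewrite (le_lt_trans (ler_distD (rv (f w)) _ _))// (splitr e) ltrD//; last first.
    exact: le_lt_trans fw Ne.
  apply: dE; rewrite (le_lt_trans (ler_distD (mid N i) _ _))// (splitr d) ltrD//.
    exact: le_lt_trans yi Nd.
  by rewrite distrC (le_lt_trans wi).
exists i0; split; last by exists p.
move=> w wi0; apply: rU.
rewrite (le_lt_trans (ler_distD (mid N i0) _ _))// (splitr r) ltrD//.
  by rewrite (le_lt_trans (half_le _ xi0)).
by rewrite distrC (le_lt_trans wi0).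
Qed.

End grid.

(** * Interpolating between the cores *)

Lemma continuous_lincomb {R : realType} (X : topologicalType) (I : Type)
    (s : seq I) (a : I -> R) (p : I -> X -> R) :
  (forall i, continuous (p i)) -> continuous (fun x => \sum_(i <- s) a i * p i x).
Proof.
move=> cp; elim: s => [|i s IHs] x.
  by under eq_fun do rewrite big_nil; exact: cst_continuous.
under eq_fun do rewrite big_cons.
apply: cvgD; last exact: IHs.
by apply: cvgMl_tmp; exact: cp.
Qed.

Lemma continuous_div {R : realType} (X : topologicalType) (p q : X -> R) :
  (forall x, q x != 0) -> continuous p -> continuous q ->
  continuous (fun x => p x / q x).
Proof.
move=> q0 cp cq x; apply: cvgM; first exact: cp.
by apply: cvgV => //; exact: cq.
Qed.

Section interpolation.
Context {R : realType} {N M : nat}.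
Hypotheses (N0 : (0 < N)%N) (M0 : (0 < M)%N).
Local Notation T := ('I_N * 'I_M)%type.
Implicit Types (t u : T) (x y : I01 R).

(** Cells are indexed by the block and the position in the block, which makes
    independent copies of a map on the blocks easy to write, see [copies]. *)
Definition cell_mid t : R := mid (N * M) (t.1 * M + t.2).

Definition mesh : R := (N * M)%:R^-1.

Lemma mesh_gt0 : 0 < mesh.
Proof. by rewrite invr_gt0 ltr0n muln_gt0 N0. Qed.

Lemma index_lt t : (t.1 * M + t.2 < N * M)%N.
Proof.
apply: (@leq_trans (t.1 * M + M)); first by rewrite ltn_add2l.
by rewrite addnC -mulSn leq_mul2r ltn_ord orbT.
Qed.

Lemma cell_mid_sep t u : t != u -> mesh <= `|cell_mid t - cell_mid u|.
Proof.
move=> tu; apply: mid_sep; first by rewrite muln_gt0 N0.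
apply: contra tu => /eqP H; rewrite -pair_eqE /pair_eq /= -!val_eqE /=.
have := congr1 (modn^~ M) H; rewrite !modnMDl !modn_small// => ->.
have := congr1 (divn^~ M) H; rewrite !divnMDl// !divn_small// !addn0 => ->.
by rewrite !eqxx.
Qed.

Lemma cell_mid_cover (r : R) : 0 <= r <= 1 -> exists t, `|r - cell_mid t| <= mesh / 2.
Proof.
move=> r01; have [|k rk] := @mid_cover R (N * M) r _ r01; first by rewrite muln_gt0 N0.
have k1 : (k %/ M < N)%N by rewrite ltn_divLR.
have k2 : (k %% M < M)%N by rewrite ltn_mod.
by exists (Ordinal k1, Ordinal k2); rewrite /cell_mid/= -divn_eq.
Qed.

Lemma cell_mid_itv t : mesh / 2 <= cell_mid t <= 1 - mesh / 2.
Proof. by apply: mid_itv; exact: index_lt. Qed.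

Variable rho : R.
Hypotheses (rho0 : 0 < rho) (rho_lt : rho < mesh / 2).

Lemma core_disjoint t u (r : R) :
  `|r - cell_mid t| <= rho -> `|r - cell_mid u| <= rho -> t = u.
Proof.
have r2 := rho_lt.
rewrite !ler_norml => /andP[? ?] /andP[? ?]; apply/eqP; apply/contraT => /cell_mid_sep.
by rewrite leNgt => /negP; case; rewrite ltr_norml; apply/andP; split; lra.
Qed.

(** A tent of radius mesh - rho about the midpoint of t.  It vanishes on all
    other cores, because midpoints are at least mesh apart, and the tents cover
    the interval because mesh - rho exceeds mesh / 2. *)
Definition tent t x : R := Num.max 0 (mesh - rho - `|rv x - cell_mid t|).

Lemma tent_ge0 t x : 0 <= tent t x.
Proof. by rewrite le_max lexx. Qed.

Lemma tent_sum_gt0 x : 0 < \sum_t tent t x.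
Proof.
have [t xt] := cell_mid_cover (rv_itv x).
rewrite (bigD1 t)//= ltr_pwDl//; last by apply: sumr_ge0 => u _; exact: tent_ge0.
rewrite lt_max; apply/orP; right; rewrite subr_gt0 (le_lt_trans xt)//.
by have r2 := rho_lt; lra.
Qed.

Lemma tent_core t u x : `|rv x - cell_mid t| <= rho -> u != t -> tent u x = 0.
Proof.
move=> xt /cell_mid_sep ut; apply: max_l; rewrite subr_le0 leNgt; apply/negP => xu.
move: xt xu; rewrite ler_norml ltr_norml => /andP[? ?] /andP[? ?].
by move: ut; rewrite leNgt => /negP; case; rewrite ltr_norml; apply/andP; split; lra.
Qed.

(** Weighted average for the partition of unity obtained by normalizing
    the tents. *)
Definition interp (w : T -> R) x : R := (\sum_t w t * tent t x) / \sum_t tent t x.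

(** Only the tent of t is nonzero on the core of t. *)
Lemma interp_core w t x : `|rv x - cell_mid t| <= rho -> interp w x = w t.
Proof.
move=> xt; have := tent_sum_gt0 x; rewrite /interp.
have -> : \sum_u w u * tent u x = w t * tent t x.
  by rewrite (bigD1 t)//= big1 ?addr0// => u ut; rewrite (tent_core xt)// mulr0.
have -> : \sum_u tent u x = tent t x.
  by rewrite (bigD1 t)//= big1 ?addr0// => u ut; rewrite (tent_core xt).
by move=> t0; rewrite mulfK// gt_eqF.
Qed.

(** A weighted average of values near v is near v. *)
Lemma interp_near w x (v e : R) :
  (forall t, `|rv x - cell_mid t| < mesh -> `|w t - v| <= e) -> `|interp w x - v| <= e.
Proof.
move=> H; have s0 := tent_sum_gt0 x.
have -> : interp w x - v = (\sum_t (w t - v) * tent t x) / \sum_t tent t x.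
  under [in RHS]eq_bigr do rewrite mulrBl.
  by rewrite sumrB -mulr_sumr mulrBl mulfK// gt_eqF.
rewrite normrM [X in _ * X]gtr0_norm ?invr_gt0// ler_pdivrMr//.
apply: le_trans (ler_norm_sum _ _ _) _; rewrite mulr_sumr ler_sum// => t _.
rewrite normrM (ger0_norm (tent_ge0 _ _)).
have [xt|xt] := ltP `|rv x - cell_mid t| mesh; first by rewrite ler_wpM2r ?tent_ge0// H.
rewrite (_ : tent t x = 0) ?mulr0//; apply: max_l.
by rewrite subr_le0 (le_trans _ xt)// gerBl ltW.
Qed.

Lemma continuous_interp w : continuous (interp w).
Proof.
have ct t : continuous (tent t).
  have -> : tent t = ((cst 0 : I01 R -> R^o) \max
      (fun x => mesh - rho - `|rv x - cell_mid t| : R^o)) by [].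
  move=> x; apply: continuous_max; first exact: cst_continuous.
  apply: (@continuousB R R^o); first exact: cst_continuous.
  apply: continuous_comp; last exact: norm_continuous.
  apply: (@continuousB R R^o); last exact: cst_continuous.
  exact: continuous_I01_val.
have cs (a : T -> R) : continuous (fun x => \sum_t a t * tent t x).
  exact: continuous_lincomb.
apply: continuous_div => [x||]; first by rewrite gt_eqF// tent_sum_gt0.
  exact: cs.
rewrite (_ : (fun x => _) = fun x => \sum_t 1 * tent t x); first exact: cs.
by apply/funext => x; apply: eq_bigr => t _; rewrite mul1r.
Qed.

End interpolation.
Arguments mesh {R} N M.

(** * The perturbation *)

Section gridded.
Context {R : realType}.
Implicit Types (f g h : C01 R) (x y : I01 R) (U : set (I01 R)).

(** M independent copies of tau: the second index is preserved, so orbits in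
    different copies never meet. *)
Definition copies N M (tau : 'I_N -> 'I_N) (t : 'I_N * 'I_M) := (tau t.1, t.2).

(** The length allowed for gaps and neighborhoods.  There are 2L + 1 covering
    intervals, and with s = 1/(m+1) their s-dimensional sizes add up to
    exactly 1/(m+1), see [fineness_powR]. *)
Definition fineness (m L : nat) : R := (m.+1%:R^-1 / (L.*2.+1)%:R) ^+ m.+1.

Lemma fineness_gt0 m L : 0 < fineness m L.
Proof. by rewrite exprn_gt0// divr_gt0// invr_gt0 ltr0n. Qed.

(** Each core (radius rho) is mapped into the concentric part of radius delta of
    the core of its target, and some block inside U is periodic.  No condition
    on the gaps between cores is imposed. *)
Record grid_dynamics U m f N M (tau : 'I_N -> 'I_N) (rho delta : R) : Prop := {
  grid_rows : (0 < N)%N;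
  grid_copies : (m.+1 < M)%N;
  grid_delta_gt0 : 0 < delta;
  grid_delta_lt : delta < rho;
  grid_rho_lt : rho < mesh N M / 2;
  grid_delta_small : delta *+ 2 <= fineness m (N * M);
  grid_gap_small : mesh N M - rho *+ 2 <= fineness m (N * M);
  grid_core : forall (t : 'I_N * 'I_M) x, `|rv x - cell_mid t| <= rho ->
    `|rv (f x) - cell_mid (copies tau t)| <= delta;
  grid_periodic : exists i0 : 'I_N,
    (forall x, `|rv x - mid N i0| <= N%:R^-1 -> U x) /\
    exists2 n, (0 < n)%N & iter n tau i0 = i0 }.

Definition gridded U m f :=
  exists N M (tau : 'I_N -> 'I_N) rho delta, grid_dynamics U m f M tau rho delta.

(** The map is clamped to make its values points of the interval, although they
    are averages of such points.  All maps within delta of the interpolated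
    map g have [grid_dynamics], since g is constant on cores. *)
Lemma gridded_dense f x U m (e : R) : 0 < e -> Omega f x -> nbhs x U ->
  exists g, ball f e g /\ interior (gridded U m) g.
Proof.
move=> e0 Ox Ux; have e40 : 0 < e / 4 by rewrite divr_gt0.
have [N [N0 Ne [tau [tauP per]]]] := coarse_grid e40 Ox Ux.
have [M mM] : exists M, (m.+1 < M)%N by exists m.+2.
have M0 : (0 < M)%N by exact: leq_ltn_trans mM.
pose L := (N * M)%N.
have l0 : 0 < mesh N M :> R by exact: mesh_gt0.
have w0 := fineness_gt0 m L; set w := fineness m L in w0.
(* z is half the width of a gap; the bound mesh / 4 keeps rho positive. *)
pose z := Num.min (mesh N M / 4) (w / 2).
have [z0 zl zw] : [/\ 0 < z, z <= mesh N M / 4 & z <= w / 2].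
  by rewrite /z lt_min !ge_min !lexx !divr_gt0 ?orbT.
pose rho := mesh N M / 2 - z.
have rho0 : 0 < rho by rewrite /rho; lra.
have rhol : rho < mesh N M / 2 by rewrite /rho; lra.
pose delta := Num.min (rho / 2) (w / 2).
have [d0 dr dw] : [/\ 0 < delta, delta <= rho / 2 & delta <= w / 2].
  by rewrite /delta lt_min !ge_min !lexx !divr_gt0 ?orbT.
pose v (t : 'I_N * 'I_M) : R := cell_mid (copies tau t).
have v01 t : 0 <= v t <= 1.
  have /andP[v0 v1] := @cell_mid_itv R N M (copies tau t).
  by rewrite /v; move: l0 v0 v1; rewrite /mesh => *; apply/andP; split; lra.
pose G y : R := interp rho v y.
have G01 y : 0 <= G y <= 1.
  have /interp_near : forall t, `|rv y - cell_mid t| < mesh N M -> `|v t - 2^-1| <= 2^-1.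
    by move=> t _; have /andP[? ?] := v01 t; rewrite ler_norml; apply/andP; split; lra.
  move=> /(_ N0 M0 rho rho0 rhol); rewrite ler_norml => /andP[? ?].
  by apply/andP; rewrite /G; split; lra.
have cG : continuous (fun y => clamp (G y)).
  move=> y; apply: continuous_comp; last exact: continuous_clamp.
  exact: continuous_interp.
pose g : C01 R := mkcts cG.
have gE y : rv (g y) = G y by rewrite /= clampK.
have gcore t y : `|rv y - cell_mid t| <= rho -> rv (g y) = v t.
  by move=> yt; rewrite gE; exact: interp_core.
exists g; split.
  rewrite ball_C01E => y; rewrite distrC gE (@le_lt_trans _ _ (e / 2))//; last by lra.
  apply: interp_near => // t yt.
  have ci (i : 'I_N) (a : 'I_M) :
      `|cell_mid (i, a) - mid N i| <= N%:R^-1 / 2 - mesh N M / 2 :> R.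
    exact: mid_refine.
  have lN : mesh N M <= N%:R^-1 :> R.
    by rewrite /mesh lef_pV2 ?posrE ?ltr0n ?muln_gt0 ?N0// ler_nat leq_pmulr.
  have yi : `|rv y - mid N t.1| <= N%:R^-1.
    have := ci t.1 t.2; rewrite -surjective_pairing.
    move: yt; rewrite ltr_norml !ler_norml => /andP[? ?] /andP[? ?].
    by apply/andP; split; lra.
  have vt : `|v t - mid N (tau t.1)| <= N%:R^-1 / 2 - mesh N M / 2 := ci _ _.
  move: vt (tauP _ _ yi); rewrite ltr_norml !ler_norml => /andP[h1 h2] /andP[h3 h4].
  move: (v t) (rv (f y)) (mid N (tau t.1)) (mesh N M) l0 Ne h1 h2 h3 h4 => a b c d.
  by move=> *; apply/andP; split; lra.
apply/nbhs_ballP; exists delta => //= h; rewrite ball_C01E => gh.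
exists N, M, tau, rho, delta; split => //.
- by lra.
- by rewrite mulr2n -[fineness _ _]/w; lra.
- by rewrite mulr2n -[fineness _ _]/w /rho; lra.
- by move=> t y /gcore yt; rewrite -/(v t) -yt distrC ltW.
Qed.

End gridded.

(** * Consequences of grid dynamics *)

Section consequences.
Context {R : realType}.
Implicit Types (f g h : C01 R) (x y : I01 R) (U W : set (I01 R)).

Lemma closed_cball (c r : R) : closed (cball c r).
Proof.
move=> x cx; rewrite /cball/= leNgt; apply/negP => rx.
have d0 : 0 < `|rv x - c| - r by rewrite subr_gt0.
have [y [/= yr xy]] : cball c r `&` [set y | `|rv x - rv y| < `|rv x - c| - r] !=set0.
  by apply: cx; apply/nbhs_I01P; exists (`|rv x - c| - r).
have := ler_distD (rv y) (rv x) c; rewrite leNgt => /negP; apply.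
by rewrite -ltrBrDr (lt_le_trans xy)// lerB.
Qed.

Lemma iter_copies N M (tau : 'I_N -> 'I_N) n (t : 'I_N * 'I_M) :
  iter n (copies tau) t = (iter n tau t.1, t.2).
Proof. by elim: n => [|n IHn]; [case: t|rewrite !iterS IHn]. Qed.

Section one_grid.
Variables (U : set (I01 R)) (m : nat) (f : C01 R).
Variables (N M : nat) (tau : 'I_N -> 'I_N) (rho delta : R).
Hypothesis G : grid_dynamics U m f M tau rho delta.
Implicit Type t : 'I_N * 'I_M.
Local Notation L := (N * M)%N.

Let N0 : (0 < N)%N := grid_rows G.
Let M0 : (0 < M)%N := leq_ltn_trans (leq0n _) (grid_copies G).

Lemma grid_rho_gt0 : 0 < rho.
Proof. exact: lt_trans (grid_delta_gt0 G) (grid_delta_lt G). Qed.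

Lemma grid_iterS n t x : `|rv x - cell_mid t| <= rho ->
  `|rv (iter n.+1 f x) - cell_mid (iter n.+1 (copies tau) t)| <= delta.
Proof.
move=> xt; elim: n => [|n IHn]; first exact: (grid_core G).
rewrite iterS [X in cell_mid X]iterS; apply: (grid_core G).
exact: le_trans IHn (ltW (grid_delta_lt G)).
Qed.

Lemma grid_iter n t x : `|rv x - cell_mid t| <= rho ->
  `|rv (iter n f x) - cell_mid (iter n (copies tau) t)| <= rho.
Proof.
case: n => // n /(grid_iterS n) H.
exact: le_trans H (ltW (grid_delta_lt G)).
Qed.

Lemma core_itv t : 0 <= cell_mid t - rho /\ cell_mid t + rho <= 1 :> R.
Proof.
have /andP[] := @cell_mid_itv R N M t; rewrite -/(mesh N M).
have := grid_rho_lt G; move: (mesh N M) (cell_mid t) => l c.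
by move=> *; split; lra.
Qed.

Lemma grid_trap n i a : (0 < n)%N -> iter n tau i = i ->
  trap f (cball (@cell_mid R N M (i, a)) rho).
Proof.
move=> n0 ti; have [c0 c1] := core_itv (i, a); have r0 := grid_rho_gt0.
split; first exact: closed_cball.
  exists rho => //; rewrite lam_cball//; last exact: ltW.
  by rewrite lte_fin mulr2n ltrDl.
exists n => // _ [x xW <-]; have := grid_iter n xW.
by rewrite iter_copies /= ti.
Qed.

Lemma core_sub_cell (i : 'I_N) (a : 'I_M) x :
  `|rv x - cell_mid (i, a)| <= rho -> `|rv x - mid N i| <= N%:R^-1.
Proof.
move=> xi; have ca : `|cell_mid (i, a) - mid N i| <= N%:R^-1 / 2 - mesh N M / 2 :> R.
  exact: mid_refine.
move: xi ca (grid_rho_lt G); rewrite !ler_norml => /andP[+ +] /andP[+ +].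
have : 0 < N%:R^-1 :> R by rewrite invr_gt0 ltr0n.
move: (mesh N M) (cell_mid (i, a)) (mid N i) (rv x) N%:R^-1 => l c p r n.
by move=> *; apply/andP; split; lra.
Qed.

(** A point outside the open cores lies within half a gap of an endpoint of its
    cell, and these endpoints are the L + 1 points j / L. *)
Lemma grid_gap x : (exists t, `|rv x - cell_mid t| < rho) \/
  exists2 j, (j <= L)%N & `|rv x - j%:R / L%:R| <= fineness m L / 2.
Proof.
have [t xt] := @cell_mid_cover R N M N0 M0 _ (rv_itv x).
have [xr|rx] := ltP `|rv x - cell_mid t| rho; first by left; exists t.
right; pose k := (t.1 * M + t.2)%N.
have cE : cell_mid t = (k%:R + 2^-1) / L%:R :> R by [].
have L0 : L%:R != 0 :> R by rewrite pnatr_eq0 muln_eq0 negb_or -!lt0n N0.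
have [c0|c0] := leP (cell_mid t) (rv x).
- exists k.+1; first exact: index_lt.
  have kE : k.+1%:R / L%:R = cell_mid t + mesh N M / 2 :> R.
    by rewrite cE /mesh -natr1; move: (L%:R : R) (k%:R : R) L0 => l q l0; field.
  move: (grid_gap_small G) rx xt; rewrite kE mulr2n ger0_norm ?subr_ge0//.
  rewrite ler_norml; move: (mesh N M) (cell_mid t) (rv x) (fineness m L) c0 => l c r w.
  by move=> *; apply/andP; split; lra.
- exists k; first exact/ltnW/index_lt.
  have kE : k%:R / L%:R = cell_mid t - mesh N M / 2 :> R.
    by rewrite cE /mesh; move: (L%:R : R) (k%:R : R) L0 => l q l0; field.
  move: (grid_gap_small G) rx xt; rewrite kE mulr2n ltr0_norm ?subr_lt0//.
  rewrite ler_norml; move: (mesh N M) (cell_mid t) (rv x) (fineness m L) c0 => l c r w.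
  by move=> *; apply/andP; split; lra.
Qed.

(** The image of a core lies within delta of a midpoint, so a point of
    the core farther than delta from the midpoint has a neighborhood that never
    returns. *)
Lemma grid_Omega t x : Omega f x -> `|rv x - cell_mid t| < rho ->
  `|rv x - cell_mid t| <= delta.
Proof.
move=> Ox xr; rewrite leNgt; apply/negP => dx.
(* Within e of x, points stay in the core and farther than delta from its midpoint. *)
pose e := Num.min (rho - `|rv x - cell_mid t|) (`|rv x - cell_mid t| - delta).
have e0 : 0 < e by rewrite lt_min !subr_gt0 xr.
pose V := [set y : I01 R | `|rv x - rv y| < e].
have Vx : nbhs x V by apply/nbhs_I01P; exists e.
have VP y : V y -> `|rv y - cell_mid t| <= rho /\ delta < `|rv y - cell_mid t|.
  move=> xy; split.
    rewrite (le_trans (ler_distD (rv x) _ _))// -lerBrDr distrC (le_trans (ltW xy))//.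
    by rewrite ge_min lexx.
  rewrite ltNge; apply/negP => yd.
  have := ler_distD (rv y) (rv x) (cell_mid t); rewrite leNgt => /negP; apply.
  by rewrite -ltrBrDr (lt_le_trans xy)// ge_min; apply/orP; right; rewrite lerB.
have [n n0 [_ [[y Vy <-] Vny]]] := Ox V Vx.
have [yr _] := VP _ Vy; have [nyr ynd] := VP _ Vny.
case: n n0 nyr ynd {Vny} => // n _ nyr ynd.
have H := grid_iterS n yr.
have /(core_disjoint N0 M0 (grid_rho_lt G) nyr) tE := le_trans H (ltW (grid_delta_lt G)).
by move: ynd; rewrite ltNge tE H.
Qed.

Lemma grid_Omega_cover : Omega f `<=`
  \bigcup_(j in `I_(L.*2.+1)) cball (if (j < L)%N then mid L j else (j - L)%:R / L%:R)
    (fineness m L / 2).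
Proof.
move=> x Ox; have [[t xt]|[j jL xj]] := grid_gap x.
  exists (t.1 * M + t.2)%N => /=.
    by rewrite (leq_trans (index_lt t))// -addnn leqW// leq_addr.
  rewrite index_lt /cball/= (le_trans (grid_Omega Ox xt))//.
  by have := grid_delta_small G; rewrite mulr2n; lra.
exists (j + L)%N => /=; first by rewrite -addnn ltnS leq_add2r.
by rewrite ltnNge leq_addl/= addnK.
Qed.

(** The cores of two neighboring cells of a periodic block are mapped towards
    their midpoints by an iterate, so the right end of the first core moves
    left and the left end of the second core moves right. *)
Lemma grid_crossing : exists n, exists a b : I01 R,
  [/\ (0 < n)%N, rv a < rv b, rv (iter n f a) < rv a & rv b < rv (iter n f b)].
Proof.
have [i [_ [n n0 ti]]] := grid_periodic G.
have M1 : (1 < M)%N by apply: leq_trans (grid_copies G).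
pose t0 := (i, Ordinal M0); pose t1 := (i, Ordinal M1).
have [c00 c01] := core_itv t0; have [c10 c11] := core_itv t1.
have r0 := grid_rho_gt0.
pose a : I01 R := clamp (cell_mid t0 + rho); pose b : I01 R := clamp (cell_mid t1 - rho).
have aE : rv a = cell_mid t0 + rho by rewrite clampK//; apply/andP; split; lra.
have bE : rv b = cell_mid t1 - rho by rewrite clampK//; apply/andP; split; lra.
have fE t x : t.1 = i -> `|rv x - cell_mid t| <= rho ->
    `|rv (iter n f x) - cell_mid t| <= delta.
  case: n n0 ti => // k _ ti t1i /(grid_iterS k); rewrite iter_copies.
  by rewrite t1i ti -t1i -surjective_pairing.
exists n, a, b; split=> //.
- have : mesh N M <= cell_mid t1 - cell_mid t0 :> R.
    rewrite /cell_mid /mid /mesh -mulrBl opprD addrACA subrr addr0 -natrB ?leq_add2l//.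
    by rewrite subnDl subn0 mul1r.
  have := grid_rho_lt G; rewrite aE bE; move: (mesh N M) => l *; lra.
- have /(fE t0 _ erefl) : `|rv a - cell_mid t0| <= rho by rewrite aE addrAC subrr add0r gtr0_norm.
  have := grid_delta_lt G; rewrite aE ler_norml => ? /andP[? ?]; lra.
- have /(fE t1 _ erefl) : `|rv b - cell_mid t1| <= rho.
    by rewrite bE addrAC subrr add0r normrN gtr0_norm.
  have := grid_delta_lt G; rewrite bE ler_norml => ? /andP[? ?]; lra.
Qed.

End one_grid.

Lemma gridded_traps U m f : gridded U m f -> exists W1 W2,
  [/\ trap f W1, trap f W2, W1 `<=` U, W2 `<=` U & W1 `&` W2 = set0].
Proof.
move=> [N [M [tau [rho [delta G]]]]].
have N0 := grid_rows G.
have M0 : (0 < M)%N := leq_ltn_trans (leq0n _) (grid_copies G).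
have M1 : (1 < M)%N by apply: leq_trans (grid_copies G).
have [i [iU [n n0 ti]]] := grid_periodic G.
exists (cball (cell_mid (i, Ordinal M0)) rho), (cball (cell_mid (i, Ordinal M1)) rho).
split; [exact: (grid_trap G _ n0 ti)|exact: (grid_trap G _ n0 ti)| | |].
- by move=> x /(core_sub_cell G)/iU.
- by move=> x /(core_sub_cell G)/iU.
- apply/seteqP; split=> // x [x0 x1].
  by have := core_disjoint N0 M0 (grid_rho_lt G) x0 x1.
Qed.

End consequences.

(** * Basins of invariant measures *)

Section basins.
Context {R : realType}.
Implicit Types (f g h : C01 R) (x y : I01 R) (U W : set (I01 R)).

Lemma continuous_measurable (phi : I01 R -> R) :
  continuous phi -> measurable_fun [set: borel01 R] (phi : borel01 R -> R).
Proof.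
move=> cphi mD; apply: (measurability _ (RGenOInfty.measurableE R)) => //.
move=> /= _ [_ [r ->] <-]; rewrite setTI; apply: sub_sigma_algebra.
by apply: open_comp => [? _|]; [exact: cphi|exact: interval_open].
Qed.

(** Nonnegativity lets the integral be computed without an integrability
    argument. *)
Lemma integral_empirical f x n (phi : I01 R -> R) :
  continuous phi -> (forall y, 0 <= phi y) ->
  (\int[empirical f x n]_y (phi y)%:E = (n%:R^-1 * \sum_(i < n) phi (iter i f x))%:E)%E.
Proof.
move=> cphi phi0; have mphi := continuous_measurable cphi.
have mphiE : measurable_fun [set: borel01 R] (fun y => (phi y)%:E) by exact/measurable_EFinP.
rewrite /empirical ge0_integral_mscale//; last by move=> y _; rewrite lee_fin.
rewrite ge0_integral_measure_sum//; last by move=> y _; rewrite lee_fin.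
rewrite EFinM -sumEFin; congr (_ * _)%E; apply: eq_bigr => i _.
by rewrite integral_dirac// diracT mul1e.
Qed.

(** If phi is constant along the orbit of x, then the empirical averages of phi
    are constant too, and so is their limit. *)
Lemma basin_average f (mu : probability (borel01 R) R) x (phi : I01 R -> R) (c : R) :
  basin f mu x -> continuous phi -> (forall y, 0 <= phi y) ->
  (forall i, phi (iter i f x) = c) -> (\int[mu]_y (phi y)%:E = c%:E)%E.
Proof.
move=> xmu cphi phi0 phic.
have lim : (\int[empirical f x n]_y (phi y)%:E @[n --> \oo] --> c%:E)%E.
  rewrite -(cvg_shiftn 1%N)/=.
  rewrite (_ : (fun n => _) = cst c%:E); first exact: cvg_cst.
  apply/funext => n; rewrite /= integral_empirical//; congr EFin.
  rewrite (eq_bigr (fun=> c)) => [|i _]; last exact: phic.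
  by rewrite sumr_const card_ord -[c *+ _]mulr_natl mulKf// addn1 pnatr_eq0.
exact: (cvg_unique _ (xmu phi cphi) lim).
Qed.

(** The function phi equals 1 on the cores of the copy of t and 0 on the cores of
    the other copies.  Along the orbit of x it is constantly 1, so its integral
    is 1; if y were in another copy the integral would also be 0. *)
Lemma grid_same_copy U m f N M (tau : 'I_N -> 'I_N) (rho delta : R)
    (mu : probability (borel01 R) R) (t u : 'I_N * 'I_M) x y :
  grid_dynamics U m f M tau rho delta -> basin f mu x -> basin f mu y ->
  `|rv x - cell_mid t| <= rho -> `|rv y - cell_mid u| <= rho -> t.2 = u.2.
Proof.
move=> G xmu ymu xt yu; apply/eqP; apply/contraT => tu.
have N0 := grid_rows G.
have M0 : (0 < M)%N := leq_ltn_trans (leq0n _) (grid_copies G).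
have r0 := grid_rho_gt0 G; have rl := grid_rho_lt G.
pose phi := interp rho (fun s : 'I_N * 'I_M => (s.2 == t.2)%:R : R).
have cphi : continuous phi by exact: continuous_interp.
have phi0 z : 0 <= phi z.
  by rewrite mulr_ge0 ?invr_ge0 ?(ltW (tent_sum_gt0 _ _ _ _))// sumr_ge0// => s _;
    rewrite mulr_ge0// tent_ge0.
have /(basin_average xmu cphi phi0) E1 i : phi (iter i f x) = 1.
  rewrite /phi (interp_core N0 M0 rl _ (grid_iter G i xt)).
  by rewrite iter_copies eqxx.
have /(basin_average ymu cphi phi0) E0 i : phi (iter i f y) = 0.
  rewrite /phi (interp_core N0 M0 rl _ (grid_iter G i yu)).
  by rewrite iter_copies /= eq_sym (negbTE tu).
by have /eqP := E1; rewrite E0 eqe eq_sym oner_eq0.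
Qed.

Lemma fineness_base_le1 m L : m.+1%:R^-1 / (L.*2.+1)%:R <= 1 :> R.
Proof.
by rewrite ler_pdivrMr ?ltr0n// mul1r (@le_trans _ _ 1)// ?invf_le1 ?ler1n.
Qed.

Lemma fineness_sum_le m L : fineness m L *+ L.*2.+1 <= m.+1%:R^-1 :> R.
Proof.
pose q : R := m.+1%:R^-1 / (L.*2.+1)%:R.
have q0 : 0 <= q by rewrite divr_ge0// invr_ge0.
apply: (@le_trans _ _ (q *+ L.*2.+1)).
  rewrite ler_wMn2r// /fineness -/q exprS ler_piMr// exprn_ile1//.
  exact: fineness_base_le1.
by rewrite -[q *+ _]mulr_natr /q divfK// pnatr_eq0.
Qed.

(** The basin meets the cores of at most one copy.  These are N cores of length
    below 1/(NM), hence of total length at most 1/M, and the gaps add at most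
    1/(m+1). *)
Lemma gridded_basin U m f (mu : probability (borel01 R) R) :
  gridded U m f -> (lam (basin f mu) <= (2 * m.+1%:R^-1)%:E)%E.
Proof.
move=> [N [M [tau [rho [delta G]]]]].
have N0 := grid_rows G.
have M0 : (0 < M)%N := leq_ltn_trans (leq0n _) (grid_copies G).
have r0 := grid_rho_gt0 G; have rl := grid_rho_lt G.
have w0 : 0 < fineness m (N * M) :> R by exact: fineness_gt0.
pose L := (N * M)%N.
have [a aP] : exists a : 'I_M, forall x (t : 'I_N * 'I_M), basin f mu x ->
    `|rv x - cell_mid t| <= rho -> t.2 = a.
  have [[x [t [xmu xt]]]|nx] := pselect (exists x (t : 'I_N * 'I_M),
      basin f mu x /\ `|rv x - cell_mid t| <= rho).
    by exists t.2 => y u ymu yu; exact: grid_same_copy G ymu xmu yu xt.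
  by exists (Ordinal M0) => x t xmu xt; exfalso; apply: nx; exists x, t.
(* The first N intervals are the cores of copy a, the others cover the gaps. *)
pose p j : R := if (j < N)%N then mid L (j * M + a) else (j - N)%:R / L%:R.
pose w j : R := if (j < N)%N then rho else fineness m L / 2.
have w_ge0 j : 0 <= w j by rewrite /w; case: ifP => _; rewrite ltW// divr_gt0.
have /le_trans : (lam (basin f mu) <= (\sum_(j < N + L.+1) w j *+ 2)%:E)%E.
  apply: (lam_cover (p := p)) => // x xmu.
  have [[t xt]|[j jL xj]] := grid_gap G x.
    exists t.1 => /=; first by rewrite (leq_trans (ltn_ord _))// leq_addr.
    rewrite /cball/= /p /w ltn_ord -(aP x t xmu (ltW xt)); exact: ltW.
  exists (N + j)%N => /=; first by rewrite ltn_add2l.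
  by rewrite /cball/= /p /w ltnNge leq_addr/= addKn.
apply; rewrite lee_fin big_split_ord/=.
under eq_bigr => i _ do rewrite /w ltn_ord.
under [X in _ + X]eq_bigr => i _ do rewrite /w ltnNge leq_addr/=.
rewrite !sumr_const !card_ord.
have -> : (fineness m L / 2) *+ 2 = fineness m L :> R by rewrite mulr2n -splitr.
have H1 : fineness m L *+ L.+1 <= m.+1%:R^-1 :> R.
  apply: le_trans (fineness_sum_le m L); rewrite ler_pMn2l//.
  by rewrite ltnS -addnn leq_addr.
have H2 : (rho *+ 2) *+ N <= m.+1%:R^-1.
  have /le_trans : (rho *+ 2) *+ N <= mesh N M *+ N.
    by rewrite ler_wMn2r// mulr2n; move: rl; move: (mesh N M) => l ?; lra.
  apply; rewrite /mesh natrM invfM -[_ *+ N]mulr_natr mulrAC mulVf ?mul1r ?pnatr_eq0 -?lt0n//.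
  by rewrite lef_pV2 ?posrE ?ltr0n// ler_nat ltnW// (grid_copies G).
by rewrite mulr2n mulrDl mul1r lerD.
Qed.

End basins.

(** * Dimension of finely covered sets *)

Section small_sets.
Context {R : realType}.
Implicit Types (f g h : C01 R) (x y : I01 R) (U W A : set (I01 R)).

(** The form of the coverings that [grid_Omega_cover] provides for Omega f; the
    covering for m serves all dimensions above 1/(m+1). *)
Definition finely_covered A := forall m, exists L (p : nat -> R),
  A `<=` \bigcup_(j in `I_(L.*2.+1)) cball (p j) (fineness m L / 2).

Lemma inv_small (e : R) : 0 < e -> exists m, m.+1%:R^-1 < e.
Proof.
move=> e0; have [m _ /(_ m (leqnn m)) /= me] := near_infty_natSinv_lt (PosNum e0).
by exists m.
Qed.

(** The coverings have arbitrarily small total length, so the set contains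
    no interval. *)
Lemma finely_covered_gap A (a b : I01 R) : finely_covered A -> rv a < rv b ->
  exists2 z, rv a < rv z < rv b & ~ A z.
Proof.
move=> cA ab; apply: contrapT => nz.
have sub : `]rv a, rv b[%classic `<=` @I01_val R @` A.
  move=> s /=; rewrite in_itv/= => /andP[as_ sb].
  have /andP[a0 _] := rv_itv a; have /andP[_ b1] := rv_itv b.
  have sE : rv (clamp s) = s by rewrite clampK//; apply/andP; split; lra.
  exists (clamp s) => //; apply: contrapT => nA; apply: nz.
  by exists (clamp s); rewrite ?sE ?as_.
have ba0 : 0 < rv b - rv a by rewrite subr_gt0.
have [m mba] := inv_small ba0.
have [L [p Ap]] := cA m.
have : ((rv b - rv a)%:E <= (m.+1%:R^-1)%:E)%E; last by rewrite lee_fin leNgt mba.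
have -> : ((rv b - rv a)%:E = lebesgue_measure (`]rv a, rv b[%classic : set R))%E.
  by rewrite lebesgue_measure_itv/= lte_fin ab EFinB.
have /le_trans : (lebesgue_measure (`]rv a, rv b[%classic : set R) <= lam A)%E.
  exact: le_outer_measure.
apply.
have w0 : 0 <= fineness m L / 2 :> R by rewrite divr_ge0// ltW// fineness_gt0.
apply: le_trans (lam_cover (w := fun=> fineness m L / 2) (fun=> w0) Ap) _.
rewrite lee_fin sumr_const card_ord [_ / 2 *+ 2]mulr2n -splitr.
exact: fineness_sum_le.
Qed.

Lemma finely_covered_totally_disconnected A :
  finely_covered A -> totally_disconnected A.
Proof.
move=> cA x Ax; apply/seteqP; split=> [y [C [Cx CA cC] Cy]|_ ->]; last first.
  exact: connected_component_refl.
have cI : is_interval (@I01_val R @` C).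
  apply/connected_intervalP; apply: connected_continuous_connected => //.
  by apply: continuous_subspaceT; exact: continuous_I01_val.
apply: contrapT => /= yx.
have H (a b : I01 R) : C a -> C b -> ~ rv a < rv b.
  move=> Ca Cb ab; have [z /andP[az zb]] := finely_covered_gap cA ab; apply.
  have [|c Cc cz] := cI (rv a) (rv b) (imageP _ Ca) (imageP _ Cb) (rv z).
    by rewrite !ltW.
  by apply: CA; rewrite -(rv_inj cz).
have [xy|yx'|/rv_inj//] := ltgtP (rv x) (rv y).
- exact: H Cx Cy xy.
- exact: H Cy Cx yx'.
- by move=> xy; apply: yx.
Qed.

Lemma diam_set0 : diam (set0 : set (I01 R)) = 0.
Proof. by rewrite /diam setX0 image_set0 sup0. Qed.

Lemma diam_ge0 A : 0 <= diam A.
Proof.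
have [[x Ax]|/set0P/negP/negPn/eqP->] := pselect (A !=set0); last by rewrite diam_set0.
apply: ub_le_sup; last by exists (x, x); rewrite //= subrr normr0.
exists 1 => _ [[y z] _ <-] /=.
have /andP[? ?] := rv_itv y; have /andP[? ?] := rv_itv z.
by rewrite ler_norml; apply/andP; split; lra.
Qed.

Lemma diam_cball (c r : R) : 0 <= r -> diam (cball c r) <= r *+ 2.
Proof.
move=> r0; have [[x xc]|/set0P/negP/negPn/eqP->] := pselect (cball c r !=set0); last first.
  by rewrite diam_set0 mulrn_wge0.
apply: ge_sup; first by exists (`|rv x - rv x|); exists (x, x).
move=> _ [[y z] [/= yc zc] <-] /=.
by rewrite (le_trans (ler_distD c _ _))// mulr2n lerD// distrC.
Qed.

Lemma fineness_powR m L :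
  fineness m L `^ m.+1%:R^-1 = m.+1%:R^-1 / (L.*2.+1)%:R :> R.
Proof.
have q0 : 0 <= m.+1%:R^-1 / (L.*2.+1)%:R :> R by rewrite divr_ge0// invr_ge0.
by rewrite /fineness -powR_mulrn// -powRrM divff ?pnatr_eq0// powRr1.
Qed.

(** With m large, 1/(m+1) is below s, d and e.  The covering sets have diameter
    at most 1, so raising the diameters to the larger power s decreases the
    sum, which is at most 1/(m+1) for the exponent 1/(m+1). *)
Lemma finely_covered_premeasure A (s d : R) : finely_covered A ->
  0 < s -> 0 < d -> hausdorff_premeasure s d A = 0%E.
Proof.
move=> cA s0 d0; apply/eqP; rewrite eq_le; apply/andP; split; last first.
  apply/ereal_infP => _ [U _ <-]; apply: nneseries_ge0 => n _ _.
  by rewrite lee_fin powR_ge0.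
apply/lee_addgt0Pr => e e0; rewrite add0e.
have [m] : exists m, m.+1%:R^-1 < Num.min s (Num.min d e).
  by apply: inv_small; rewrite !lt_min s0 d0.
rewrite !lt_min => /and3P[ms md me].
have [L [p Ap]] := cA m.
pose K := L.*2.+1; pose w : R := fineness m L.
have w0 : 0 < w by exact: fineness_gt0.
have wm : w *+ K <= m.+1%:R^-1 by exact: fineness_sum_le.
have wm1 : w <= m.+1%:R^-1.
  by apply: le_trans wm; rewrite -[leLHS]mulr1n ler_wpMn2l// ltW.
have w1 : w <= 1 by rewrite (le_trans wm1)// invf_le1 ?ltr0n// ler1n.
pose U j : set (I01 R) := if (j < K)%N then cball (p j) (w / 2) else set0.
have dU j : diam (U j) <= if (j < K)%N then w else 0.
  rewrite /U; case: ifP => _; last by rewrite diam_set0.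
  rewrite (le_trans (diam_cball _ _)) ?mulr2n -?splitr//.
  by rewrite divr_ge0// ltW.
apply: ge_ereal_inf; exists (\sum_(0 <= i <oo) (diam (U i) `^ s)%:E)%E.
  exists U => //; split=> [x /Ap[j jK xj]|j].
    by exists j => //; rewrite /U jK.
  by rewrite (le_trans (dU j))//; case: ifP => _; rewrite ?ltW// (le_lt_trans wm1).
pose c : R := m.+1%:R^-1 / K%:R.
have c0 : 0 <= c by rewrite divr_ge0// invr_ge0.
have Uc j : diam (U j) `^ s <= if (j < K)%N then c else 0.
  have := dU j; case: ifP => _ dj; last first.
    have -> : diam (U j) = 0 by apply/eqP; rewrite eq_le dj diam_ge0.
    by rewrite powR0// gt_eqF.
  rewrite /c -fineness_powR -/w.
  apply: (@le_trans _ _ (w `^ s)).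
    by apply: ge0_ler_powR; rewrite ?nnegrE ?diam_ge0 // ltW.
  by apply: ger_powR; rewrite ?w0// ltW.
apply: lime_le.
  by apply: is_cvg_nneseries => n _ _; rewrite lee_fin powR_ge0.
apply: nearW => n; rewrite sumEFin lee_fin big_mkord.
apply: (@le_trans _ _ (\sum_(i < n) if (i < K)%N then c else 0)).
  by apply: ler_sum => i _; exact: Uc.
apply: (@le_trans _ _ (c *+ minn n K)).
  elim: n => [|n IHn]; first by rewrite big_ord0 min0n mulr0n.
  rewrite big_ord_recr/=; case: ltnP => nK.
    by rewrite (minn_idPl nK) mulrSr lerD2r (le_trans IHn)// (minn_idPl (ltnW nK)).
  by rewrite addr0 (le_trans IHn)// ler_wpMn2l// (minn_idPr nK) (minn_idPr (leqW nK)).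
rewrite (@le_trans _ _ (c *+ K))//; first by rewrite ler_wpMn2l// geq_minr.
by rewrite -[c *+ K]mulr_natr /c divfK ?pnatr_eq0// ltW.
Qed.

Lemma finely_covered_hausdorff_dim A : finely_covered A -> hausdorff_dim A = 0%E.
Proof.
move=> cA; have mA (s : R) : 0 < s -> hausdorff_measure s A = 0%E.
  move=> s0; rewrite /hausdorff_measure.
  rewrite (_ : [set _ | _ in _] = [set 0%E]) ?ereal_sup1//.
  apply/seteqP; split=> [_ [d /= d0 <-]|_ ->].
    exact: finely_covered_premeasure.
  by exists 1; rewrite /= ?ltr01// finely_covered_premeasure.
apply/eqP; rewrite eq_le; apply/andP; split; last first.
  by apply/ereal_infP => _ [s [s0 _] <-]; rewrite lee_fin ltW.
apply/lee_addgt0Pr => e e0; rewrite add0e.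
by apply: ge_ereal_inf; exists e%:E => //; exists e => //; split => //; exact: mA.
Qed.

End small_sets.

(** * Lyapunov instability *)

Section instability.
Context {R : realType}.
Implicit Types (f g h : C01 R) (x y : I01 R) (U W A : set (I01 R)).

Lemma continuous_orbit f n : continuous (fun r : R => rv (iter n f (clamp r))).
Proof.
move=> r; apply: (@continuous_comp _ _ _ (@clamp R) (fun x => rv (iter n f x))).
  exact: continuous_clamp.
apply: (@continuous_comp _ _ _ (iter n f) (@I01_val R)).
  exact: continuous_iter.
exact: continuous_I01_val.
Qed.

(** The point q is the supremum of the points of [a, b] that are not moved to the
    right; by continuity it is fixed. *)
Lemma crossing_repeller f n (a b : I01 R) : rv a < rv b ->
  rv (iter n f a) < rv a -> rv b < rv (iter n f b) ->
  exists2 q, rv q < rv b & iter n f q = q /\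
    forall s, rv q < rv s <= rv b -> rv s < rv (iter n f s).
Proof.
move=> ab fa fb; pose F r := rv (iter n f (clamp r)).
have cF : continuous F by exact: continuous_orbit.
pose S := [set r : R | rv a <= r <= rv b /\ F r <= r].
have Sa : S (rv a) by split; [rewrite lexx ltW|rewrite /F clamp_val ltW].
have ubS : ubound S (rv b) by move=> r [/andP[]].
have supS : has_sup S by split; [exists (rv a)|exists (rv b)].
pose q := sup S.
have aq : rv a <= q by apply: ub_le_sup => //; exists (rv b).
have qb : q <= rv b by apply: ge_sup => //; exists (rv a).
have /andP[a0 _] := rv_itv a; have /andP[_ b1] := rv_itv b.
have qE : rv (clamp q) = q by rewrite clampK//; apply/andP; split; lra.
have above r : q < r -> r <= rv b -> r < F r.
  move=> qr rb; rewrite ltNge; apply/negP => Fr.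
  have : r <= q.
    by apply: ub_le_sup; [exists (rv b)|split => //; rewrite rb ltW// (le_lt_trans aq)].
  by rewrite leNgt qr.
have Fq : F q <= q.
  rewrite leNgt; apply/negP => qF.
  have : \forall r \near q, r < F r.
    have cG : continuous (fun r => F r - r).
      by move=> r; apply: cvgB; [exact: cF|exact: cvg_id].
    have : \forall r \near q, 0 < F r - r by apply: (cvgr_gt _ (cG q)); rewrite subr_gt0.
    by apply: filterS => r; rewrite subr_gt0.
  move=> /nbhs_ballP[e /= e0 eF].
  have [r Sr qr] := sup_adherent e0 supS.
  have rq : r <= q by apply: ub_le_sup => //; exists (rv b).
  have /eF : ball q e r by rewrite /ball/= ger0_norm ?subr_ge0// ltrBlDl -ltrBlDr.
  by rewrite ltNge => /negP; apply; case: Sr.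
have qb' : q < rv b.
  rewrite lt_neqAle qb andbT; apply/eqP => qbE.
  by move: Fq; rewrite qbE /F clamp_val leNgt fb.
have Fq' : q <= F q.
  rewrite leNgt; apply/negP => qF.
  have : \forall r \near q, F r < q by apply: (cvgr_lt _ (cF q)).
  move=> /nbhs_ballP[e /= e0 eF].
  pose r := q + Num.min (e / 2) (rv b - q).
  have qr : q < r by rewrite ltrDl lt_min divr_gt0//= subr_gt0.
  have rb : r <= rv b by rewrite -lerBrDl ge_min lexx orbT.
  have re : r < q + e by rewrite ltrD2l gt_min ltr_pdivrMr// ltr_pMr// ltr1n.
  have /eF : ball q e r by rewrite /ball/= distrC ger0_norm ?subr_ge0 ?(ltW qr)// ltrBlDl.
  by have := above r qr rb; lra.
exists (clamp q); rewrite ?qE//; split.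
  by apply: rv_inj; rewrite qE; apply/eqP; rewrite eq_le Fq Fq'.
by move=> s /andP[qs sb]; have := above _ qs sb; rewrite /F clamp_val.
Qed.

(** Let V be the neighborhood that stability yields for the complement of z.  The
    iterates of a small interval [q, t] inside V contain q and avoid z, so they
    stay below z.  The supremum s of the orbit of t is then at most z and larger
    than q, so it is moved to the right; by continuity some point of the
    orbit is moved beyond s. *)
Lemma crossing_not_stable f A n (a b : I01 R) : (0 < n)%N -> rv a < rv b ->
  rv (iter n f a) < rv a -> rv b < rv (iter n f b) ->
  (forall q, iter n f q = q -> A q) ->
  (forall a b : I01 R, rv a < rv b -> exists2 z, rv a < rv z < rv b & ~ A z) ->
  ~ lyapunov_stable f A.
Proof.
move=> n0 ab fa fb Aper Agap stable.
have [q qb [fq above]] := crossing_repeller ab fa fb.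
have [z /andP[qz zb] nAz] := Agap _ _ qb.
have [V [oV AV Vz]] : exists V : set (I01 R), [/\ open V, A `<=` V &
    forall x n, V x -> (iter n f x) <> z].
  apply: (stable (~` [set z])); last by move=> x Ax /= xz; apply: nAz; rewrite -xz.
  apply: closed_openC; apply: compact_closed; first exact: hausdorff_I01.
  exact: compact_set1.
have Vq : V q by apply: AV; exact: Aper.
have /nbhs_I01P[e e0 eV] := open_nbhs_nbhs (conj oV Vq).
have /andP[q0 _] := rv_itv q; have /andP[_ b1] := rv_itv b.
pose t := rv q + Num.min (e / 2) ((rv z - rv q) / 2).
have qt : rv q < t by rewrite ltrDl lt_min !divr_gt0// subr_gt0.
have te : t < rv q + e by rewrite ltrD2l gt_min ltr_pdivrMr// ltr_pMr// ltr1n.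
have tz : t < rv z.
  rewrite -ltrBrDl gt_min; apply/orP; right.
  by rewrite ltr_pdivrMr ?subr_gt0// ltr_pMr ?subr_gt0// ltr1n.
have clampE' r : rv q <= r <= t -> rv (clamp r) = r.
  by move=> /andP[? ?]; rewrite clampK//; apply/andP; split; lra.
have Vr r : rv q <= r <= t -> V (clamp r).
  move=> rqt; apply: eV; rewrite clampE'//; move: rqt => /andP[qr rt].
  by rewrite distrC ger0_norm ?subr_ge0// ltrBlDl (le_lt_trans rt).
have fkq k : iter (k * n) f q = q.
  by elim: k => // k IHk; rewrite mulSn iterD IHk.
have Fz k r : rv q <= r <= t -> rv (iter k f (clamp r)) != rv z.
  by move=> /Vr Vr'; apply/eqP => /rv_inj; exact: Vz.
have below k r : rv q <= r <= t -> rv (iter (k * n) f (clamp r)) < rv z.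
  move=> rqt; rewrite ltNge; apply/negP => zF.
  pose F s := rv (iter (k * n) f (clamp s)).
  have cF : continuous F by exact: continuous_orbit.
  have /andP[qr rt] := rqt.
  have [||s] := @IVT R F (rv q) r (rv z) qr.
  - exact: continuous_subspaceT.
  - have Fq : F (rv q) = rv q by rewrite /F clamp_val fkq.
    by rewrite Fq ge_min (ltW qz) le_max zF orbT.
  rewrite in_itv/= => /andP[qs sr] Fs.
  have /(Fz (k * n)%N) : rv q <= s <= t by rewrite qs (le_trans sr).
  by rewrite -/(F s) Fs eqxx.
(* The orbit of t under the n-th iterate is bounded by z but has no room for a
   supremum, since above q points move to the right. *)
pose S := [set rv (iter (k * n) f (clamp t)) | k in [set: nat]].
have St : S t by exists 0%N; rewrite //= clampE'// lexx ltW.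
have Sz : ubound S (rv z).
  by move=> _ [k _ <-]; rewrite ltW// below// lexx ltW.
have supS : has_sup S by split; [exists t|exists (rv z)].
pose s := sup S.
have ts : t <= s by apply: ub_le_sup => //; exists (rv z).
have sz : s <= rv z by apply: ge_sup => //; exists t.
have sE : rv (clamp s) = s by rewrite clampK//; apply/andP; split; lra.
have fs : s < rv (iter n f (clamp s)).
  by rewrite -{1}sE; apply: above; rewrite sE; apply/andP; split; lra.
have : \forall r \near s, s < rv (iter n f (clamp r)).
  exact: (cvgr_gt _ (@continuous_orbit f n s)).
move=> /nbhs_ballP[d /= d0 dF].
have [_ [k _ <-] sr] := sup_adherent d0 supS.
have Sk j : rv (iter (j * n) f (clamp t)) <= s.
  by apply: ub_le_sup; [exists (rv z)|exists j].
have /dF : ball s d (rv (iter (k * n) f (clamp t))).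
  by rewrite /ball/= ger0_norm ?subr_ge0// ltrBlDl -ltrBlDr.
by rewrite clamp_val -iterD -mulSn ltNge Sk.
Qed.

End instability.

(** * Generic maps *)

Section genericity.
Context {R : realType}.
Implicit Types (f g h : C01 R) (x y : I01 R) (U W A : set (I01 R)).

Lemma griddedS U W m f : U `<=` W -> gridded U m f -> gridded W m f.
Proof.
move=> UW [N [M [tau [rho [delta G]]]]]; exists N, M, tau, rho, delta.
case: G => ? ? ? ? ? ? ? ? [i [iU per]]; split => //.
by exists i; split=> // x /iU/UW.
Qed.

Lemma trap_Omega f W : trap f W -> Omega f `&` W !=set0.
Proof.
by move=> /trap_milnor[x [xL Wx]]; exists x; split => //; exact: milnor_sub_Omega.
Qed.

(** Taking interiors makes both alternatives open, so each of them speaks of all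
    maps near f. *)
Definition decided U m : set (C01 R) :=
  interior (gridded U m) `|` interior [set g | Omega g `&` U = set0].

Lemma decided_open U m : open (decided U m).
Proof. by apply: openU; exact: open_interior. Qed.

(** If the second alternative fails at f, then some map near f has a
    non-wandering point in U, and the perturbation applies to that map. *)
Lemma decided_dense U m : open U -> dense (decided U m).
Proof.
move=> oU O [f Of] oO.
have /nbhs_ballP[e /= e0 eO] : nbhs f O by exact: open_nbhs_nbhs.
have [fU|nfU] := pselect (interior [set g | Omega g `&` U = set0] f).
  by exists f; split => //; right.
have e20 : 0 < e / 2 by rewrite divr_gt0.
have [g fg [x [Ox Ux]]] : exists2 g, ball f (e / 2) g & Omega g `&` U !=set0.
  apply: contrapT => ng; apply: nfU; apply/nbhs_ballP; exists (e / 2) => //= g fg.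
  by apply: contrapT => /eqP/set0P gU; apply: ng; exists g.
have [h [gh hU]] := gridded_dense m e20 Ox (open_nbhs_nbhs (conj oU Ux)).
by exists h; split; [apply: eO; exact: ball_split fg gh|left].
Qed.

Lemma open_rat_ball q : open (@rat_ball R q).
Proof.
rewrite openE => x /= xq; apply/nbhs_I01P.
exists (q.2.+1%:R^-1 - `|rv x - ratr q.1|); first by rewrite subr_gt0.
move=> y xy; rewrite /rat_ball/=.
rewrite (le_lt_trans (ler_distD (rv x) _ _))// -ltrBrDr distrC.
by rewrite (lt_le_trans xy)// opprK subrK.
Qed.

Definition generic : set (C01 R) :=
  [set f | forall (q : rat * nat) m, decided (rat_ball q) m f].

Lemma residual_generic : residual generic.
Proof.
exists generic => //.
exists (fun k => if unpickle k is Some (q, m) then decided (rat_ball q) m else setT).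
  move=> k; case: unpickle => [[q m]|]; last first.
    by split; [exact: openT|move=> O [x Ox] _; exists x].
  by split; [exact: decided_open|apply: decided_dense; exact: open_rat_ball].
apply/seteqP; split=> [f fG k _|f fG q m]; first by case: unpickle => [[q m]|].
by have := fG (pickle (q, m)) I; rewrite pickleK.
Qed.

Lemma cvge0_squeeze (T : Type) (F : set_system T) (FF : Filter F) (d : T -> \bar R) :
  (forall e : R, 0 < e -> \forall t \near F, (0 <= d t <= e%:E)%E) ->
  d t @[t --> F] --> 0%E.
Proof.
move=> dF; have d_fin (e : R) t : (0 <= d t <= e%:E)%E -> d t \is a fin_num.
  by move=> /andP[d0 de]; rewrite ge0_fin_numE// (le_lt_trans de)// ltry.
apply/fine_cvgP; split; first by apply: filterS (dF 1 ltr01) => t /d_fin.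
apply/cvgrPdist_le => e e0; apply: filterS (dF e e0) => t /[dup]/d_fin dfin.
move=> /andP[d0 de]; rewrite sub0r normrN /= ger0_norm ?fine_ge0//.
by rewrite -lee_fin fineK.
Qed.

Section generic_map.
Variable f : C01 R.
Hypothesis Gf : generic f.

(** At a non-wandering point the second alternative of [decided] is excluded. *)
Lemma generic_gridded x U m : Omega f x -> nbhs x U -> \forall g \near f, gridded U m g.
Proof.
move=> Ox /rat_ball_basis[q xq qU].
have [fq|/interior_subset/= fq] := Gf q m.
  by apply: filterS fq => g; exact: griddedS.
by have : (Omega f `&` rat_ball q) x by []; rewrite fq.
Qed.

(** Near a wandering point the first alternative of [decided] is excluded, since
    a trap contains non-wandering points. *)
Lemma generic_wandering y : ~ Omega f y ->
  exists2 U, nbhs y U & \forall g \near f, Omega g `&` U = set0.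
Proof.
move=> nOy; have [|q yq qO] := @rat_ball_basis R y (~` Omega f).
  by apply: open_nbhs_nbhs; split => //; apply: closed_openC; exact: Omega_closed.
exists (rat_ball q); first by apply: open_nbhs_nbhs; split => //; exact: open_rat_ball.
have [/interior_subset/gridded_traps[W [_ [tW _ WU _ _]]]|//] := Gf q 0%N.
by have [x [Ox Wx]] := trap_Omega tW; have := qO _ (WU _ Wx).
Qed.

Lemma generic_trapping : trapping f.
Proof.
move=> x U Ox Ux; have /nbhs_singleton/gridded_traps := generic_gridded 0 Ox Ux.
by move=> [W [_ [tW _ WU _ _]]]; exists W.
Qed.

Lemma generic_gridded_setT m : gridded setT m f.
Proof.
have [x Ox] := Omega_nonempty f.
exact: (nbhs_singleton (generic_gridded m Ox filterT)).
Qed.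

Lemma generic_milnor : milnor_attractor f = Omega f.
Proof.
apply/seteqP; split; first exact: milnor_sub_Omega.
exact: Omega_sub_milnor generic_trapping.
Qed.

Lemma generic_stat : stat_attractor f = Omega f.
Proof.
apply/seteqP; split; first exact: stat_sub_Omega.
exact: Omega_sub_stat generic_trapping.
Qed.

Lemma generic_phys : phys_attractor f = Omega f.
Proof.
apply/seteqP; split; first exact: phys_sub_Omega.
exact: Omega_sub_phys generic_trapping.
Qed.

Lemma generic_finely_covered : finely_covered (Omega f).
Proof.
move=> m; have [N [M [tau [rho [delta G]]]]] := generic_gridded_setT m.
exists (N * M)%N, (fun j => if (j < N * M)%N then mid (N * M) j
  else (j - N * M)%:R / (N * M)%:R).
exact: grid_Omega_cover G.
Qed.

(** Of the two non-wandering points provided by disjoint traps, at least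
    one differs from x. *)
Lemma generic_perfect : perfect_set (Omega f).
Proof.
split; first exact: Omega_closed.
apply/seteqP; split=> [x xl|x Ox U Ux].
  by apply: Omega_closed => U /xl[y [_ Oy Uy]]; exists y.
have /nbhs_singleton/gridded_traps := generic_gridded 0 Ox Ux.
move=> [W1 [W2 [/trap_Omega[y [Oy W1y]] /trap_Omega[z [Oz W2z]] W1U W2U W12]]].
have [yx|yx] := eqVneq y x; last by exists y; split => //; exact: W1U.
exists z; split => //; last exact: W2U.
apply/eqP => zx; have : (W1 `&` W2) x by split; [rewrite -yx|rewrite -zx].
by rewrite W12.
Qed.

Lemma generic_cantor : cantor_set (Omega f).
Proof.
split; first exact: Omega_nonempty.
- exact: (subclosed_compact (@Omega_closed _ f) compact_I01).
- exact: generic_perfect.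
- exact: finely_covered_totally_disconnected generic_finely_covered.
Qed.

Lemma generic_not_stable : ~ lyapunov_stable f (Omega f).
Proof.
have [N [M [tau [rho [delta G]]]]] := generic_gridded_setT 0.
have [n [a [b [n0 ab fa fb]]]] := grid_crossing G.
apply: (crossing_not_stable n0 ab fa fb) => [q|c d].
  exact: periodic_Omega.
exact: finely_covered_gap generic_finely_covered.
Qed.

Lemma generic_basin (mu : probability (borel01 R) R) : lam (basin f mu) = 0%E.
Proof.
apply/eqP; rewrite eq_le; apply/andP; split; last exact: outer_measure_ge0.
apply/lee_addgt0Pr => e e0; rewrite add0e.
have [|m me] := @inv_small R (e / 2); first by rewrite divr_gt0.
apply: le_trans (gridded_basin mu (generic_gridded_setT m)) _.
by rewrite lee_fin mulrC -ler_pdivlMr// ltW.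
Qed.

(** Compactness of the interval makes a property that holds locally in the
    point, for all maps near f, hold at all points for all maps near f. *)
Lemma near_forall_I01 (P : C01 R -> I01 R -> Prop) :
  (forall x, exists2 U, nbhs x U & \forall g \near f, forall y, U y -> P g y) ->
  \forall g \near f, forall y, P g y.
Proof.
move=> HP.
have : \forall g \near f, [set: I01 R] `<=` P g.
  apply: ((compact_near_coveringP [set: I01 R]).1 compact_I01 _ (nbhs f) P _) => x _.
  have [U Ux UP] := HP x.
  exists (U, [set g | forall y, U y -> P g y]); first by split.
  by move=> [y g] /= [Uy]; apply.
by apply: filterS => g gP y; exact: gP.
Qed.

(** Wandering points stay wandering under perturbation, so the attractor
    of g cannot leave the neighborhood of that of f. *)
Lemma generic_milnor_upper (e : R) : 0 < e ->
  \forall g \near f, forall y, milnor_attractor g y ->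
    exists2 x, milnor_attractor f x & ball y e x.
Proof.
move=> e0; apply: near_forall_I01 => x.
have [Ox|/generic_wandering[U Ux UP]] := pselect (Omega f x).
  exists (ball x e); first exact: nbhsx_ballx.
  apply: (@filterE _ (nbhs f)) => g y xy _; exists x; last exact: ball_sym.
  by rewrite generic_milnor.
exists U => //; apply: filterS UP => g gU y Uy /milnor_sub_Omega Oy.
by have : (Omega g `&` U) y by []; rewrite gU.
Qed.

(** Traps persist under perturbation, so each point of the attractor of f
    is approximated by points of the attractor of g. *)
Lemma generic_milnor_lower (e : R) : 0 < e ->
  \forall g \near f, forall y, milnor_attractor f y ->
    exists2 x, milnor_attractor g x & ball y e x.
Proof.
move=> e0; apply: near_forall_I01 => x; rewrite generic_milnor.
have [Ox|nOx] := pselect (Omega f x); last first.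
  exists (~` Omega f); last by apply: (@filterE _ (nbhs f)).
  by apply: open_nbhs_nbhs; split => //; apply: closed_openC; exact: Omega_closed.
have xe : nbhs x (ball x (e / 2)) by apply: nbhsx_ballx; rewrite divr_gt0.
exists (ball x (e / 2)) => //.
apply: filterS (generic_gridded 0 Ox xe) => g /gridded_traps.
move=> [W [_ [/trap_milnor[z [Lz Wz]] _ WU _ _]]] y xy _.
by exists z => //; apply: ball_split (ball_sym xy) (WU _ Wz).
Qed.

Lemma hausdorff_dist_le (A B : set (I01 R)) (e : R) : 0 < e ->
  (forall a, A a -> exists2 b, B b & ball a e b) ->
  (forall b, B b -> exists2 a, A a & ball b e a) ->
  (hausdorff_dist A B <= e%:E)%E.
Proof.
move=> e0 AB BA; rewrite /hausdorff_dist ge_max; apply/andP; split.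
  apply: ge_ereal_sup => _ [a /AB[b Bb ab] <-]; apply: ge_ereal_inf.
  by exists (edist (a, b)); [exists b|exact: edist_fin].
apply: ge_ereal_sup => _ [b /BA[a Aa ba] <-]; apply: ge_ereal_inf.
by exists (edist (b, a)); [exists a|exact: edist_fin].
Qed.

Lemma hausdorff_dist_ge0 (A B : set (I01 R)) : A !=set0 -> (0 <= hausdorff_dist A B)%E.
Proof.
move=> [a Aa]; rewrite /hausdorff_dist le_max; apply/orP; left.
by apply: le_ereal_sup_tmp; exists (edist_inf B a); [exists a|exact: edist_inf_ge0].
Qed.

Lemma generic_robust : milnor_robust f.
Proof.
apply: (@cvge0_squeeze _ _ (nbhs_filter f)) => e e0.
apply: filterS (filterI (generic_milnor_upper e0) (generic_milnor_lower e0)).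
move=> g [upper lower].
by rewrite hausdorff_dist_ge0 ?hausdorff_dist_le//; exact: milnor_attractor_nonempty.
Qed.

End generic_map.

End genericity.

Theorem theoremB (R : realType) :
  exists G : set (C01 R), residual G /\
  forall f : C01 R, G f ->
    [/\ cantor_set (Omega f), hausdorff_dim (Omega f) = 0%E,
        phys_attractor f = stat_attractor f,
        stat_attractor f = milnor_attractor f &
        milnor_attractor f = Omega f] /\
    [/\ milnor_robust f,
        ~ lyapunov_stable f (milnor_attractor f) &
        forall mu : probability (borel01 R) R,
          invariant_measure f mu -> lam (basin f mu) = 0%E].
Proof.
exists generic; split=> [|f Gf]; first exact: residual_generic.
rewrite generic_phys// generic_stat// generic_milnor//; split; split=> //.
- exact: generic_cantor.
- exact: finely_covered_hausdorff_dim (generic_finely_covered Gf).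
- exact: generic_robust.
- exact: generic_not_stable.
- by move=> mu _; exact: generic_basin.
Qed.
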